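(* Assume the strong 3SUM-hardness assumption (stated in the context). Consider the jumbled indexing problem with text size $s$ over an alphabet of size $3$. Then for any fixed $\epsilon > 0$, any algorithm for jumbled indexing satisfies at least one of the following: (1) its preprocessing time is $\Omega(s^{\frac{4}{3}-\epsilon})$, or (2) its query time is $\Omega(s^{\frac{2}{3}-\epsilon})$.
   Context: Model: Word RAM with words of $O(\log n)$ bits. The Parikh vector of a string $S$ over alphabet $\Sigma=\{\sigma_1,\dots,\sigma_{|\Sigma|}\}$ is $\psi(S)=(c_1(S),\dots,c_{|\Sigma|}(S))$, where $c_i(S)$ is the number of occurrences of $\sigma_i$ in $S$. Jumbled indexing: preprocess a text $S$ of length $s$ over alphabet $\Sigma$ so that, given a query vector $\psi\in\mathbb{N}^{|\Sigma|}$, one can decide whether some substring $S'$ of $S$ has Parikh vector $\psi(S')=\psi$. Convolution-3SUM: given integers $x_1,\dots,x_n$, decide whether there exist distinct indices $i,j$ with $x_i - x_j = x_{i-j}$. Strong 3SUM-hardness assumption: any (possibly randomized) algorithm for Convolution-3SUM requires $n^{2-o(1)}$ expected time to decide, for input $\{x_1,\dots,x_n\}\subset\{-n,\dots,n\}$, whether there is a pair $x_i,x_j$ with $x_i-x_j=x_{i-j}$.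
   Formalization: Ω is read as ''at least a constant times the bound for infinitely many s'' (not little-o), also in the hardness assumption; with ''for all large s'' the either/or fails for an algorithm that alternates strategies for even and odd s. *)

(* Defs.v *)
From HB Require Import structures.
From mathcomp Require Import all_boot all_order all_algebra.
From mathcomp Require Import all_classical all_reals all_analysis.

Set Implicit Arguments.
Unset Strict Implicit.
Unset Printing Implicit Defensive.

Import Order.TTheory GRing.Theory Num.Theory.

Local Open Scope classical_set_scope.
Local Open Scope ring_scope.

(** * Randomized word RAM *)

Inductive binop :=
  | OpAdd | OpSub | OpMul | OpDiv | OpAnd | OpOr | OpXor | OpShl | OpShr
  | OpEq | OpLt.

(* [d], [a], [b] are register numbers and [l] is a program position. *)
Inductive instr :=
  | Const (d k : nat)        (* R_d := k *)
  | Op (o : binop) (d a b : nat)   (* R_d := R_a o R_b *)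
  | Read (d a : nat)         (* R_d := M[R_a] *)
  | Write (a b : nat)        (* M[R_a] := R_b *)
  | Rand (d : nat)           (* R_d := uniformly random word *)
  | Jump (l : nat)
  | JumpIfZero (a l : nat).

Definition program := seq instr.

(* Words of [w] bits are represented by the naturals below [2 ^ w]. *)
Record config := Config {
  pc : nat;
  regs : nat -> nat;
  memory : nat -> nat }.

Definition upd (f : nat -> nat) (a v : nat) : nat -> nat :=
  fun i => if i == a then v else f i.

Definition eval_op (w : nat) (o : binop) (x y : nat) : nat :=
  (match o with
   | OpAdd => (x + y) %% 2 ^ w
   | OpSub => (x + (2 ^ w - y)) %% 2 ^ w
   | OpMul => (x * y) %% 2 ^ w
   | OpDiv => x %/ y
   | OpAnd => Nat.land x y
   | OpOr => Nat.lor x y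
   | OpXor => Nat.lxor x y
   | OpShl => (x * 2 ^ y) %% 2 ^ w
   | OpShr => x %/ 2 ^ y
   | OpEq => x == y
   | OpLt => x < y
   end)%N.

(* A run halts when the program counter leaves the program. *)
Definition halted (p : program) (c : config) : bool := (size p <= pc c)%N.

(* [r] is the random word drawn for this step; only [Rand] looks at it. *)
Definition step (w : nat) (p : program) (r : nat) (c : config) : config :=
  let: Config l R M := c in
  match nth (Jump l) p l with
  | Const d k => Config l.+1 (upd R d (k %% 2 ^ w)%N) M
  | Op o d a b => Config l.+1 (upd R d (eval_op w o (R a) (R b))) M
  | Read d a => Config l.+1 (upd R d (M (R a))) M
  | Write a b => Config l.+1 R (upd M (R a) (R b))
  | Rand d => Config l.+1 (upd R d r) M
  | Jump l' => Config l' R M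
  | JumpIfZero a l' => Config (if R a == 0%N then l' else l.+1) R M
  end.

(* Words of O(log n) bits; the constant factor [c] belongs to the algorithm.
   The summand 2 makes the integers in [-n, n] representable when [0 < c]. *)
Definition word_bits (c n : nat) : nat := (c * (trunc_log 2 n + 2))%N.

Section Expectations.
Variable R : realType.
Variables (w : nat) (p : program).
Local Open Scope ereal_scope.

Definition average (f : nat -> \bar R) : \bar R :=
  ((2 ^ w)%:R^-1)%:E * \sum_(0 <= r < (2 ^ w)%N) f r.

(* Expectation of [F] at the final configuration, restricted to the runs from
   [c] that halt within [k] steps. *)
Fixpoint halt_expect_within (F : config -> \bar R) (k : nat) (c : config)
    : \bar R :=
  if halted p c then F c else
  if k is k'.+1
  then average (fun r => halt_expect_within F k' (step w p r c)) else 0.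

(* For [0 <= F] the sequence in [k] is nondecreasing, so the supremum is the
   expectation over all halting runs. *)
Definition halt_expect (F : config -> \bar R) (c : config) : \bar R :=
  ereal_sup (range (fun k => halt_expect_within F k c)).

Definition halt_prob (E : set config) (c : config) : \bar R :=
  halt_expect (fun c' => (\1_E c')%:E) c.

(* Expectation of the minimum of [k] and the number of steps before halting. *)
Fixpoint truncated_time (k : nat) (c : config) : \bar R :=
  if halted p c then 0 else
  if k is k'.+1
  then 1 + average (fun r => truncated_time k' (step w p r c)) else 0.

(* Expected number of steps, by monotone convergence; it is [+oo] in particular
   if the run from [c] diverges with positive probability. *)
Definition expected_time (c : config) : \bar R :=
  ereal_sup (range (fun k => truncated_time k c)).

End Expectations.

Definition answers (Q : Prop) : set config := [set c | regs c 0%N != 0%N <-> Q].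

(* Lower bounds in the sense of Hardy and Littlewood: [f] is not o([g]). *)
Definition is_Omega (R : realType) (f : nat -> \bar R) (g : nat -> R) : Prop :=
  exists2 a : R, 0 < a &
    forall N : nat, exists2 n : nat, (N <= n)%N & ((a * g n)%:E <= f n)%E.

(** * Convolution-3SUM *)

(* An instance of size [n] is [x 1, ..., x n]; other values are irrelevant.
   The index [i - j] has to be positive, whence [j < i]. *)
Definition conv3sum (n : nat) (x : nat -> int) : Prop :=
  exists i j : nat,
    [/\ (0 < j)%N, (j < i)%N, (i <= n)%N & x i - x j = x (i - j)%N].

Definition small_instance (n : nat) (x : nat -> int) : Prop :=
  forall i : nat, (0 < i <= n)%N -> - n%:Z <= x i <= n%:Z.

Record algorithm := Algorithm {
  alg_prog : program;
  alg_word : nat;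
  alg_word_gt0 : (0 < alg_word)%N }.

(* Register 0 holds [n]; cell [i] holds [x i] in two's complement. *)
Definition conv3sum_init (w n : nat) (x : nat -> int) : config :=
  Config 0 (upd (fun=> 0%N) 0 n)
    (fun i => if (0 < i <= n)%N then `|(x i %% (2 ^ w)%N%:Z)%Z|%N else 0%N).

Definition solves_conv3sum (R : realType) (A : algorithm) : Prop :=
  forall (n : nat) (x : nat -> int), small_instance n x ->
    let w := word_bits (alg_word A) n in
    halt_prob R w (alg_prog A) (answers (conv3sum n x)) (conv3sum_init w n x)
    = 1%E.

Definition conv3sum_time (R : realType) (A : algorithm) (n : nat) : \bar R :=
  let w := word_bits (alg_word A) n in
  ereal_sup [set expected_time R w (alg_prog A) (conv3sum_init w n x)
            | x in small_instance n].

(* Every algorithm needs n^(2 - o(1)) expected time. *)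
Definition strong_3sum_hardness (R : realType) : Prop :=
  forall A : algorithm, solves_conv3sum R A ->
  forall delta : R, 0 < delta ->
    is_Omega (conv3sum_time R A) (fun n => n%:R `^ (2 - delta)).

(** * Jumbled indexing *)

Definition parikh (sigma : nat) (S : seq 'I_sigma) : {ffun 'I_sigma -> nat} :=
  [ffun i => count_mem i S].

Definition jumbled_occurs (sigma : nat) (S : seq 'I_sigma)
    (psi : {ffun 'I_sigma -> nat}) : Prop :=
  exists2 S' : seq 'I_sigma, infix S' S & parikh S' = psi.

Record indexing_algorithm := IndexingAlgorithm {
  idx_preprocess : program;
  idx_query : program;
  idx_word : nat;
  idx_word_gt0 : (0 < idx_word)%N }.

Definition idx_bits (A : indexing_algorithm) (s : nat) : nat :=
  word_bits (idx_word A) s.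

(* Register 0 holds the length of [S]; cell [i] holds its [i]-th letter,
   counting from 0. *)
Definition preprocess_init (sigma : nat) (S : seq 'I_sigma) : config :=
  Config 0 (upd (fun=> 0%N) 0 (size S))
    (fun i => nth 0%N [seq nat_of_ord a | a <- S] i).

(* The memory left by the preprocessing is the index; the query vector is
   passed in the registers. *)
Definition query_init (sigma : nat) (psi : {ffun 'I_sigma -> nat})
    (index : config) : config :=
  Config 0 (fun i => if insub i is Some a then psi a else 0%N) (memory index).

(* Each entry of a query vector is one machine word. *)
Definition word_vector (sigma w : nat) (psi : {ffun 'I_sigma -> nat}) : Prop :=
  forall a : 'I_sigma, (psi a < 2 ^ w)%N.

Definition solves_jumbled_indexing (R : realType) (sigma : nat)
    (A : indexing_algorithm) : Prop :=
  forall (S : seq 'I_sigma) (psi : {ffun 'I_sigma -> nat}),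
    let w := idx_bits A (size S) in
    word_vector w psi ->
    halt_expect w (idx_preprocess A)
      (fun c => halt_prob R w (idx_query A) (answers (jumbled_occurs S psi))
                  (query_init psi c))
      (preprocess_init S) = 1%E.

Definition preprocessing_time (R : realType) (sigma : nat)
    (A : indexing_algorithm) (s : nat) : \bar R :=
  ereal_sup [set expected_time R (idx_bits A s) (idx_preprocess A)
                   (preprocess_init S)
            | S in [set S : seq 'I_sigma | size S = s]].

(* The expectation is over the random choices of both phases. *)
Definition query_time (R : realType) (sigma : nat)
    (A : indexing_algorithm) (s : nat) : \bar R :=
  let w := idx_bits A s in
  ereal_sup [set halt_expect w (idx_preprocess A)
                   (fun c => expected_time R w (idx_query A)
                               (query_init Spsi.2 c))
                   (preprocess_init Spsi.1)
            | Spsi in [set Spsi : seq 'I_sigma * {ffun 'I_sigma -> nat} |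
                        size Spsi.1 = s /\ word_vector w Spsi.2]].

(* Main.v *)
Require Import Defs.
From HB Require Import structures.
From mathcomp Require Import all_boot all_order all_algebra.
From mathcomp Require Import all_classical all_reals all_analysis.
From mathcomp Require Import zify ring lra.

(** Let [B] be the least integer with [n < B ^ 2] and write [x i + B ^ 2 = B *
    y i + z i] with [0 <= z i < B]. The text is a first half followed by a
    second half, each made of [n] blocks; in either half the [i]-th block
    contains the letter 0 twice, the letter 1 [2 (C + y i - y (i - 1))] times
    and the letter 2 [2 (C + z i - z (i - 1))] times, where [C = 2 B + 1]. The
    order of the letters within a block differs between the halves, in such a
    way that the parities of the letter counts of a proper prefix of a block
    determine the half. A substring with even counts and more than [2 n]
    letters 0 thus runs from a block boundary [j] of the first half to a block
    boundary [i] of the second one, and its counts reveal [i - j], [y i - y j]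
    and [z i - z j]. Two queries per difference [i - j], one for each possible
    carry from [z] to [y], decide Convolution-3SUM. The text has length O(n ^
    (3/2)), so preprocessing in time s ^ (4/3 - eps) and queries in time s ^
    (2/3 - eps) would give n ^ (2 - 3/2 eps) in total.

    The machine for the text is simulated with constant overhead. Each query
    must start from the index left by the preprocessing: its writes go to an
    overlay whose cells carry the number of the query as a stamp, so that
    nothing has to be undone. *)

Set Implicit Arguments.
Unset Strict Implicit.
Unset Printing Implicit Defensive.

Import Order.TTheory GRing.Theory Num.Theory.

Local Open Scope classical_set_scope.
Local Open Scope ring_scope.

(** * Expected running times and halting probabilities *)

(** The text writes numbers in unary, so a number of size [n] would cost [n] letters per block; two
    digits in base about the square root of [n] cost only that root each. This is where the exponent
    3/2 and the three letters come from: one letter per digit and one that counts blocks.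
    Differences of digits can be negative, hence the shift [C]; a substring between boundaries [j]
    and [i] contains a multiple of [C] that depends only on [n + (i - j)], which the letter 0
    reveals.

    Two obstacles come from the machine model. The preprocessing may be randomized, and all [2 n]
    queries share its one random index, so they are not independent: correctness rests on
    intersecting almost sure events, and the running time on linearity of expectation alone.
    Moreover the index may be far larger than the time of one query, so it cannot be copied for each
    of them. Queries are numbered downwards from [2 n] to 1, so a stamp never recurs, and 0 marks
    cells that no query has written. *)

Lemma natmul_erealE (R : realType) (x : \bar R) n :
  (x *+ n)%R = (n%:R%:E * x)%E.
Proof. exact/esym/mule_natl. Qed.

Section Average.
Variable R : realType.
Variable w : nat.
Local Open Scope ereal_scope.
Implicit Types f g : nat -> \bar R.

Lemma card_words_gt0 : (0 < (2 ^ w)%:R :> R)%R.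
Proof. by rewrite ltr0n expn_gt0. Qed.

Lemma inv_card_words_ge0 : 0 <= ((2 ^ w)%:R^-1 : R)%:E.
Proof. by rewrite lee_fin invr_ge0 ler0n. Qed.

Lemma average_ge0 f :
  (forall r, (r < 2 ^ w)%N -> 0 <= f r) -> 0 <= average w f.
Proof.
move=> f0; apply: mule_ge0; first exact: inv_card_words_ge0.
rewrite big_seq_cond; apply: sume_ge0 => r.
by rewrite mem_index_iota andbT => /andP[_ /f0].
Qed.

Lemma le_average f g :
  (forall r, (r < 2 ^ w)%N -> f r <= g r) -> average w f <= average w g.
Proof.
move=> fg; apply: lee_wpmul2l; first exact: inv_card_words_ge0.
rewrite big_seq_cond [leRHS]big_seq_cond; apply: lee_sum => r.
by rewrite mem_index_iota andbT => /andP[_ /fg].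
Qed.

Lemma eq_average f g :
  (forall r, (r < 2 ^ w)%N -> f r = g r) -> average w f = average w g.
Proof.
move=> fg; rewrite /average; congr (_ * _).
by apply: eq_big_nat => r /andP[_ /fg].
Qed.

Lemma average_cst (x : \bar R) : average w (fun=> x) = x.
Proof.
rewrite /average big_const_nat iter_addr_0 subn0 natmul_erealE muleA -EFinM.
by rewrite mulVf ?mul1e// gt_eqF// card_words_gt0.
Qed.

Lemma averageD f g : (forall r, 0 <= f r) -> (forall r, 0 <= g r) ->
  average w (fun r => f r + g r) = average w f + average w g.
Proof.
move=> f0 g0; rewrite /average big_split/= ge0_muleDr//; exact: sume_ge0.
Qed.

Lemma averageZ (x : \bar R) f : (forall r, 0 <= f r) ->
  average w (fun r => x * f r) = x * average w f.
Proof. by move=> f0; rewrite /average -ge0_sume_distrr// muleCA. Qed.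

Lemma average_eq0 f : (forall r, 0 <= f r) -> average w f = 0 ->
  forall r, (r < 2 ^ w)%N -> f r = 0.
Proof.
move=> f0 /eqP; rewrite mule_eq0 eqe invr_eq0 gt_eqF ?card_words_gt0//=.
rewrite seq_psume_eq0// => /allP f_eq0 r rw.
by apply/eqP; apply: f_eq0; rewrite mem_index_iota.
Qed.

(** Monotone convergence for a finite average; it turns the recursions on truncated runs into
    recursions on their suprema. *)
Lemma average_ereal_sup (f : nat -> nat -> \bar R) :
  (forall r k, 0 <= f r k) -> (forall r, nondecreasing_seq (f r)) ->
  ereal_sup (range (fun k => average w (fun r => f r k))) =
  average w (fun r => ereal_sup (range (f r))).
Proof.
move=> f0 f_nd.
have nd : nondecreasing_seq (fun k => average w (fun r => f r k)).
  by move=> k l kl; apply: le_average => r _; apply: f_nd.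
have /cvg_lim <- // := ereal_nondecreasing_cvgn nd.
apply/cvg_lim => //; apply: cvgeZl => //.
apply: cvg_nnesum => r _; first exact: nearW.
exact: ereal_nondecreasing_cvgn.
Qed.

End Average.

Lemma sum_nat_modn (V : nmodType) (f : nat -> V) (m d : nat) : (0 < d)%N ->
  (\sum_(0 <= r < m * d) f (r %% d)%N = (\sum_(0 <= r < d) f r) *+ m)%R.
Proof.
move=> d0; elim: m => [|m IHm]; first by rewrite mul0n big_nil mulr0n.
rewrite mulSn addnC (@big_cat_nat _ _ _ (m * d))//=; last exact: leq_addr.
rewrite IHm mulrSr; congr (_ + _)%R.
rewrite -{1}[(m * d)%N]add0n [(m * d + d)%N]addnC big_addn addnK.
by apply: eq_big_nat => r /andP[_ rd]; rewrite addnC modnMDl modn_small.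
Qed.

(** Since [2 ^ w] divides [2 ^ w'], a uniform word of [w'] bits reduced modulo [2 ^ w] is again
    uniform. This lets a machine with longer words draw the random words of a shorter one. *)
Lemma average_modn (R : realType) (w w' : nat) (f : nat -> \bar R) :
  (w <= w')%N -> (forall r, (0 <= f r)%E) ->
  average w' (fun r => f (r %% 2 ^ w)%N) = average w f.
Proof.
move=> ww' f0; rewrite /average -{2}(subnK ww') expnD sum_nat_modn ?expn_gt0//.
rewrite natmul_erealE muleA -EFinM; congr (_%:E * _)%E.
by rewrite -{1}(subnK ww') expnD natrM invfM mulrAC mulVf ?mul1r.
Qed.

Section Runs.
Variable R : realType.
Variables (w : nat) (p : program).
Local Open Scope ereal_scope.
Local Notation hew := (@halt_expect_within R w p).
Local Notation he := (@halt_expect R w p).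
Local Notation tt := (@truncated_time R w p).
Local Notation et := (@expected_time R w p).

Section Expect.
Variable F : config -> \bar R.
Hypothesis F0 : forall c, 0 <= F c.

Lemma halt_expect_within_ge0 k c : 0 <= hew F k c.
Proof.
elim: k c => [|k IHk] c /=; case: ifP => // _; apply: average_ge0 => r _.
exact: IHk.
Qed.

Lemma halt_expect_withinS k c : hew F k c <= hew F k.+1 c.
Proof.
elim: k c => [|k IHk] c /=; case: ifP => // _.
  by apply: average_ge0 => r _; exact: (halt_expect_within_ge0 0).
by apply: le_average => r _; exact: IHk.
Qed.

Lemma nondecreasing_halt_expect_within c : nondecreasing_seq (hew F ^~ c).
Proof. by apply/nondecreasing_seqP => k; exact: halt_expect_withinS. Qed.

Lemma halt_expect_within_le k c : hew F k c <= he F c.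
Proof. by apply: ereal_sup_ubound; exists k. Qed.

Lemma halt_expect_ge0 c : 0 <= he F c.
Proof.
exact: le_trans (halt_expect_within_ge0 0 c) (halt_expect_within_le 0 c).
Qed.

Lemma halt_expect_halted c : halted p c -> he F c = F c.
Proof.
move=> hc; apply/eqP; rewrite eq_le; apply/andP; split.
  by apply: ge_ereal_sup => _ [k _ <-]; case: k => [|k] /=; rewrite hc.
by apply: ereal_sup_ubound; exists 0%N => //=; rewrite hc.
Qed.

Lemma halt_expect_step c : ~~ halted p c ->
  he F c = average w (fun r => he F (step w p r c)).
Proof.
move=> /negbTE hc; rewrite -average_ereal_sup => [|r k|r]; last 2 first.
- exact: halt_expect_within_ge0.
- exact: nondecreasing_halt_expect_within.
apply/eqP; rewrite eq_le; apply/andP; split; apply: ge_ereal_sup => _ [k _ <-].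
  apply: (le_trans (halt_expect_withinS _ _)); rewrite /= hc.
  by apply: ereal_sup_ubound; exists k.
by apply: ereal_sup_ubound; exists k.+1 => //=; rewrite hc.
Qed.

End Expect.

Lemma halt_expect_withinD F G k c : (forall c, 0 <= F c) ->
  (forall c, 0 <= G c) ->
  hew (fun c => F c + G c) k c = hew F k c + hew G k c.
Proof.
move=> F0 G0; elim: k c => [|k IHk] c /=; case: ifP => // _.
  by rewrite adde0.
rewrite -averageD => [|r|r]; do ?exact: halt_expect_within_ge0.
by apply: eq_average => r _; exact: IHk.
Qed.

Lemma halt_expectD_le F G c : (forall c, 0 <= F c) -> (forall c, 0 <= G c) ->
  he (fun c => F c + G c) c <= he F c + he G c.
Proof.
move=> F0 G0; apply: ge_ereal_sup => _ [k _ <-].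
by rewrite halt_expect_withinD// leeD// halt_expect_within_le.
Qed.

Lemma halt_expectZ_le (x : \bar R) F c : 0 <= x -> (forall c, 0 <= F c) ->
  he (fun c => x * F c) c <= x * he F c.
Proof.
move=> x0 F0; apply: ge_ereal_sup => _ [k _ <-].
suff -> : hew (fun c => x * F c) k c = x * hew F k c.
  by rewrite lee_wpmul2l// halt_expect_within_le.
elim: k c => [|k IHk] c /=; case: ifP => // _; first by rewrite mule0.
rewrite -averageZ => [|r]; last exact: halt_expect_within_ge0.
by apply: eq_average => r _; exact: IHk.
Qed.

Lemma halt_expect_cst_le (x : \bar R) c : 0 <= x -> he (fun=> x) c <= x.
Proof.
move=> x0; apply: ge_ereal_sup => _ [k _ <-].
elim: k c => [|k IHk] c /=; case: ifP => // _.
by rewrite -[leRHS](average_cst w); apply: le_average => r _; exact: IHk.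
Qed.

Lemma le_halt_expect F G c : (forall c, F c <= G c) -> he F c <= he G c.
Proof.
move=> FG; apply: ge_ereal_sup => _ [k _ <-].
suff FGk : hew F k c <= hew G k c.
  by apply: (le_trans FGk); apply: ereal_sup_ubound; exists k.
elim: k c => [|k IHk] c /=; case: ifP => // _.
by apply: le_average => r _; exact: IHk.
Qed.

Lemma halt_expect_sum_le (I : Type) (s : seq I) (F : I -> config -> \bar R) c :
  (forall i c, 0 <= F i c) ->
  he (fun c => \sum_(i <- s) F i c) c <= \sum_(i <- s) he (F i) c.
Proof.
move=> F0; elim: s => [|i s IHs].
  rewrite big_nil; apply: (le_trans _ (@halt_expect_cst_le 0 c _)) => //.
  by apply: le_halt_expect => c'; rewrite big_nil.
rewrite big_cons; apply: (le_trans _ (leeD (lexx _) IHs)).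
apply: (le_trans _ (halt_expectD_le _ _ _)) => //.
  by apply: le_halt_expect => c'; rewrite big_cons.
by move=> c'; apply: sume_ge0.
Qed.

(* Every halting run has positive probability, so an arbitrary family of
   almost sure events holds simultaneously almost surely. *)
Lemma halt_prob_all (I : Type) (G : I -> config -> \bar R) c (i0 : I) :
  (forall i c, 0 <= G i c <= 1) -> (forall i, he (G i) c = 1) ->
  1 <= halt_prob R w p [set c' | forall i, G i c' = 1] c.
Proof.
move=> G01 G1; set good := [set c' | _].
have G0 i c' : 0 <= G i c' by have /andP[] := G01 i c'.
have Gfin i c' : G i c' \is a fin_num.
  have /andP[g0 g1] := G01 i c'; rewrite ge0_fin_numE//.
  exact: le_lt_trans g1 (ltry _).
have H0 i c' : 0 <= 1 - G i c'.
  by have /andP[_ ?] := G01 i c'; rewrite sube_ge0 ?Gfin.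
have one_le k : hew (fun=> 1) k c <= 1.
  exact: le_trans (halt_expect_within_le _ _ _) (halt_expect_cst_le _ lee01).
(* The expectations of [G i] and of its deficiency [1 - G i] add up to at most 1 at any two
   truncation depths, and the first of them has supremum 1. *)
have HE0 i k : hew (fun c' => 1 - G i c') k c = 0.
  apply/eqP; rewrite eq_le halt_expect_within_ge0 ?andbT//.
  have le1 l : hew (G i) l c + hew (fun c' => 1 - G i c') k c <= 1.
    apply: (le_trans _ (one_le (maxn k l))).
    rewrite (_ : (fun=> 1) = (fun c' => G i c' + (1 - G i c'))); last first.
      by apply/funext => c'; rewrite addeC subeK.
    rewrite (@halt_expect_withinD (G i) (fun c' => 1 - G i c'))//.
    by apply: leeD; apply: nondecreasing_halt_expect_within => //;
      rewrite ?leEnat ?leq_maxl ?leq_maxr.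
  have Hfin : hew (fun c' => 1 - G i c') k c \is a fin_num.
    rewrite ge0_fin_numE ?halt_expect_within_ge0//.
    apply: (@le_lt_trans _ _ 1); last exact: ltry.
    by apply: (le_trans _ (le1 0%N)); rewrite leeDr// halt_expect_within_ge0.
  have : he (G i) c <= 1 - hew (fun c' => 1 - G i c') k c.
    by apply: ge_ereal_sup => _ [l _ <-]; rewrite leeBrDr.
  by rewrite G1 leeBrDr// -[leRHS]adde0 leeD2lE.
(* Within [k] steps there are finitely many outcomes, and a finite average of nonnegative terms
   vanishes only termwise. Hence the size of the index type [I] is irrelevant. *)
have bad0 k c' : (forall i, hew (fun c' => 1 - G i c') k c' = 0) ->
    hew (fun c' => (\1_(~` good) c')%:E) k c' = 0.
  elim: k c' => [|k IHk] c' /=; case: ifP => // _ H.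
  - rewrite indicE in_setC mem_set// => i.
    by have /eqP := H i; rewrite sube_eq// add0e eq_sym => /eqP.
  - rewrite indicE in_setC mem_set// => i.
    by have /eqP := H i; rewrite sube_eq// add0e eq_sym => /eqP.
  rewrite -[RHS](average_cst w); apply: eq_average => r rw; apply: IHk => i.
  by apply: (average_eq0 _ (H i)) rw => r'; exact: halt_expect_within_ge0.
rewrite -(G1 i0); apply: ge_ereal_sup => _ [k _ <-].
apply: (@le_trans _ _ (hew (fun c' => (\1_good c')%:E) k c)).
  apply: (@le_trans _ _ (hew (fun c' => (\1_good c')%:E + (\1_(~` good) c')%:E) k c)).
    elim: k c {G1 one_le HE0} => [|k IHk] c /=; case: ifP => // _.
    - rewrite !indicE in_setC; have /andP[_ ?] := G01 i0 c.
      by case: (c \in good); rewrite ?adde0 ?add0e.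
    - rewrite !indicE in_setC; have /andP[_ ?] := G01 i0 c.
      by case: (c \in good); rewrite ?adde0 ?add0e.
    by apply: le_average => r _; exact: IHk.
  by rewrite halt_expect_withinD// bad0 ?adde0// => c'; rewrite lee_fin.
by apply: ereal_sup_ubound; exists k.
Qed.

Lemma halt_prob_ge0 E c : 0 <= halt_prob R w p E c.
Proof. by apply: halt_expect_ge0 => c'; rewrite lee_fin. Qed.

Lemma halt_prob_le1 E c : halt_prob R w p E c <= 1.
Proof.
apply: le_trans (halt_expect_cst_le c lee01); apply: le_halt_expect => c'.
by rewrite lee_fin indicE; case: (_ \in _).
Qed.

Lemma truncated_time_ge0 k c : 0 <= tt k c.
Proof.
elim: k c => [|k IHk] c /=; case: ifP => // _; apply: adde_ge0 => //.
by apply: average_ge0 => r _; exact: IHk.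
Qed.

Lemma truncated_timeS k c : tt k c <= tt k.+1 c.
Proof.
elim: k c => [|k IHk] c /=; case: ifP => // _.
  apply: adde_ge0 => //; apply: average_ge0 => r _.
  exact: (truncated_time_ge0 0).
by rewrite leeD2l//; apply: le_average => r _; exact: IHk.
Qed.

Lemma nondecreasing_truncated_time c : nondecreasing_seq (tt ^~ c).
Proof. by apply/nondecreasing_seqP => k; exact: truncated_timeS. Qed.

Lemma truncated_time_le k c : tt k c <= et c.
Proof. by apply: ereal_sup_ubound; exists k. Qed.

Lemma expected_time_ge0 c : 0 <= et c.
Proof. exact: le_trans (truncated_time_ge0 0 c) (truncated_time_le 0 c). Qed.

Lemma expected_time_halted c : halted p c -> et c = 0.
Proof.
move=> hc; apply/eqP; rewrite eq_le expected_time_ge0 andbT.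
by apply: ge_ereal_sup => _ [k _ <-]; case: k => [|k] /=; rewrite hc.
Qed.

Lemma expected_time_step c : ~~ halted p c ->
  1 + average w (fun r => et (step w p r c)) <= et c.
Proof.
move=> /negbTE hc; rewrite -average_ereal_sup => [|r k|r]; last 2 first.
- exact: truncated_time_ge0.
- exact: nondecreasing_truncated_time.
rewrite addeC -leeBrDr//; apply: ge_ereal_sup => _ [k _ <-].
rewrite leeBrDr// addeC; apply: ereal_sup_ubound.
by exists k.+1 => //=; rewrite hc.
Qed.

End Runs.

(** * Deterministic stretches of a run *)

Definition is_rand (i : instr) : bool := if i is Rand _ then true else false.

(** The draw 0 passed to [step] stands for any other, because no instruction met on the way is a
    [Rand]. *)
Fixpoint det_run (w : nat) (p : program) (t : nat) (c c' : config) : Prop :=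
  if t is t'.+1 then
    [/\ ~~ halted p c, ~~ is_rand (nth (Jump (pc c)) p (pc c))
      & det_run w p t' (step w p 0 c) c']
  else c = c'.

Lemma step_det w p r c : ~~ is_rand (nth (Jump (pc c)) p (pc c)) ->
  step w p r c = step w p 0 c.
Proof. by case: c => l R M /=; case: (nth _ _ _). Qed.

Lemma det_run_trans w p t1 t2 c1 c2 c3 : det_run w p t1 c1 c2 ->
  det_run w p t2 c2 c3 -> det_run w p (t1 + t2) c1 c3.
Proof.
elim: t1 c1 => [|t1 IHt] c1 /=; first by move=> ->.
by move=> [h1 h2 h3] h4; split => //; exact: IHt h4.
Qed.

Section DetRunExpect.
Variable R : realType.
Variables (w : nat) (p : program).
Local Open Scope ereal_scope.

Lemma det_run_expect F t c c' : (forall c, 0 <= F c) -> det_run w p t c c' ->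
  @halt_expect R w p F c = halt_expect w p F c'.
Proof.
move=> F0; elim: t c => [|t IHt] c /= => [->//|[hc rc /IHt <-]].
rewrite halt_expect_step// -[RHS](average_cst w); apply: eq_average => r _.
by rewrite step_det.
Qed.

Lemma det_run_truncated t k c c' : det_run w p t c c' ->
  truncated_time R w p (t + k) c = t%:R%:E + truncated_time R w p k c'.
Proof.
elim: t c => [|t IHt] c /= => [->|[hc rc /IHt tE]]; first by rewrite add0e.
rewrite (negbTE hc) -[t.+1]add1n natrD EFinD -addeA -tE; congr (_ + _).
by rewrite -[RHS](average_cst w); apply: eq_average => r _; rewrite step_det.
Qed.

Lemma det_run_time t c c' : det_run w p t c c' ->
  expected_time R w p c <= t%:R%:E + expected_time R w p c'.
Proof.
move=> h; apply: ge_ereal_sup => _ [k _ <-].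
apply: (@le_trans _ _ (truncated_time R w p (t + k) c)).
  by apply: nondecreasing_truncated_time; rewrite ?leEnat leq_addl.
by rewrite (det_run_truncated _ h) leeD2l// truncated_time_le.
Qed.

End DetRunExpect.

Definition code_at (p : program) (l : nat) (s : seq instr) : Prop :=
  (l + size s <= size p)%N /\
  forall j, (j < size s)%N -> nth (Jump 0) p (l + j) = nth (Jump 0) s j.

Lemma code_at_cat p l s1 s2 : code_at p l (s1 ++ s2) ->
  code_at p l s1 /\ code_at p (l + size s1) s2.
Proof.
move=> [sz h]; rewrite size_cat in sz; split; split => [|j js]; try lia.
- by rewrite h ?size_cat ?nth_cat ?js//; lia.
- rewrite -addnA h ?size_cat ?nth_cat; last lia.
  by rewrite ltnNge leq_addr/= addKn.
Qed.

Definition is_simple (i : instr) : bool :=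
  match i with Const _ _ | Op _ _ _ _ | Read _ _ | Write _ _ => true
             | _ => false end.

Definition state := ((nat -> nat) * (nat -> nat))%type.

Definition exec_simple (w : nat) (st : state) (i : instr) : state :=
  let: (R, M) := st in
  match i with
  | Const d k => (upd R d (k %% 2 ^ w)%N, M)
  | Op o d a b => (upd R d (eval_op w o (R a) (R b)), M)
  | Read d a => (upd R d (M (R a)), M)
  | Write a b => (R, upd M (R a) (R b))
  | _ => st
  end.

Lemma code_at_nth p l s j (d : instr) : code_at p l s -> (j < size s)%N ->
  nth d p (l + j) = nth (Jump 0) s j.
Proof. by move=> [sz h] js; rewrite -h//; apply: set_nth_default; lia. Qed.

Lemma det_run_simple w p l s R M : code_at p l s -> all is_simple s ->
  det_run w p (size s) (Config l R M)
    (Config (l + size s) (foldl (exec_simple w) (R, M) s).1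
                         (foldl (exec_simple w) (R, M) s).2).
Proof.
elim: s l R M => [|i s IHs] l R M; first by rewrite /= addn0.
move=> cs /andP[si ss]; have [ci cs'] := @code_at_cat _ _ [:: i] _ cs.
have ni : nth (Jump l) p l = i by rewrite -{2}[l]addn0 (code_at_nth _ cs).
have {}cs' : code_at p (l + 1) s := cs'.
have [sz _] := cs.
split; first by rewrite /halted/=; move: sz => /=; lia.
  by rewrite /= ni; case: i si {cs ci ni sz}.
rewrite /= ni -addSnnS -[l.+1]addn1.
by case: i si {cs ci ni sz} => //= *; exact: IHs.
Qed.

Lemma det_run_jump w p l l' R M : (l < size p)%N ->
  nth (Jump 0) p l = Jump l' -> det_run w p 1 (Config l R M) (Config l' R M).
Proof.
move=> lp nl; have nl' : nth (Jump l) p l = Jump l'.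
  by rewrite -nl; exact: set_nth_default.
by rewrite /= nl' /halted /= -ltnNge.
Qed.

Lemma det_run_jump_if_zero w p l a l' R M : (l < size p)%N ->
  nth (Jump 0) p l = JumpIfZero a l' ->
  det_run w p 1 (Config l R M)
    (Config (if R a == 0%N then l' else l.+1) R M).
Proof.
move=> lp nl; have nl' : nth (Jump l) p l = JumpIfZero a l'.
  by rewrite -nl; exact: set_nth_default.
by rewrite /= nl' /halted /= -ltnNge.
Qed.

Arguments det_run : simpl never.

(** * Simulating a machine with shorter words *)

Lemma Nat_powE x y : Nat.pow x y = (x ^ y)%N.
Proof. by elim: y => //= y IHy; rewrite IHy expnS. Qed.

Lemma Nat_moduloE x y : (0 < y)%N -> Nat.modulo x y = (x %% y)%N.
Proof.
move=> y0; apply/esym; apply: (PeanoNat.Nat.mod_unique _ _ (x %/ y)).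
  by apply/ssrnat.ltP; rewrite ltn_mod.
by rewrite {1}(divn_eq x y) mulnC.
Qed.

Lemma land_mask w x : Nat.land x (2 ^ w - 1) = (x %% 2 ^ w)%N.
Proof.
have := PeanoNat.Nat.land_ones x w.
by rewrite PeanoNat.Nat.ones_equiv Nat_powE Nat_moduloE ?expn_gt0// -subn1.
Qed.

Lemma eval_op_lt w o x y : (0 < w)%N -> (x < 2 ^ w)%N -> (y < 2 ^ w)%N ->
  (eval_op w o x y < 2 ^ w)%N.
Proof.
move=> w0 xw yw; have W0 : (0 < 2 ^ w)%N by rewrite expn_gt0.
have W1 : (1 < 2 ^ w)%N by rewrite -{1}(expn0 2) ltn_exp2l.
case: o => /=; rewrite ?ltn_mod//.
- exact: leq_ltn_trans (leq_div _ _) xw.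
- by rewrite -(modn_small xw) -land_mask -PeanoNat.Nat.land_assoc
    (PeanoNat.Nat.land_comm _ y) PeanoNat.Nat.land_assoc land_mask ltn_mod.
- rewrite -(modn_small xw) -(modn_small yw) -!land_mask.
  by rewrite -PeanoNat.Nat.land_lor_distr_l land_mask ltn_mod.
- rewrite -(modn_small xw) -(modn_small yw) -!land_mask.
  rewrite (_ : Nat.lxor _ _ = Nat.land (Nat.lxor x y) (2 ^ w - 1)).
    by rewrite land_mask ltn_mod.
  apply: PeanoNat.Nat.bits_inj => k.
  rewrite !(PeanoNat.Nat.lxor_spec, PeanoNat.Nat.land_spec).
  by case: (Nat.testbit x k); case: (Nat.testbit y k);
    case: (Nat.testbit (2 ^ w - 1) k).
- exact: leq_ltn_trans (leq_div _ _) xw.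
- by case: (x == y).
- by case: (x < y)%N.
Qed.

(** Modular operations agree after masking because [2 ^ w] divides [2 ^ w']; the remaining ones do
    not depend on the word length and already stay below [2 ^ w]. *)
Lemma eval_op_mask w w' o x y : (0 < w <= w')%N ->
  (x < 2 ^ w)%N -> (y < 2 ^ w)%N ->
  Nat.land (eval_op w' o x y) (2 ^ w - 1) = eval_op w o x y.
Proof.
move=> /andP[w0 ww'] xw yw; rewrite land_mask -(modn_small (eval_op_lt o w0 xw yw)).
have dv : (2 ^ w %| 2 ^ w')%N by rewrite dvdn_exp2l.
case: o => //=; rewrite ?modn_mod ?modn_dvdm//.
(* Only subtraction is left: its two offsets differ by a multiple of [2 ^ w]. *)
have -> : (2 ^ w' = 2 ^ w + (2 ^ (w' - w) - 1) * 2 ^ w)%N.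
  rewrite mulnBl -expnD subnK// mul1n subnKC// leq_exp2l//.
by rewrite -addnBAC ?(ltnW yw)// addnA addnC modnMDl.
Qed.

(* Simulated register [d] lives in register [32 + d]. The registers
   [rW = W], [rS = 2 W], [rMask = W - 1], where [W = 2 ^ w], [rQ] and [rG]
   configure the simulation; [tb] is scratch. *)
Local Notation rW := 10%N (only parsing).
Local Notation rS := 11%N (only parsing).
Local Notation rMask := 12%N (only parsing).
Local Notation rQ := 13%N (only parsing).
Local Notation rG := 14%N (only parsing).

Section SimCode.
Variables (tb off : nat) (p : program).

(** The [minn] sends every target outside the simulated program to the end of its code, so that
    halting becomes passing to the code that follows. *)
Definition sim_label (l : nat) : nat := (off + 8 * minn l (size p))%N.

(** [Read] is free of branches: the stamp is compared with the query number, and the resulting bit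
    times [g] selects the index or the overlay. With [q = g = 0], as during preprocessing, writes go
    straight into the index and leave the stamps at 0. *)
Definition sim_body (i : instr) : seq instr :=
  match i with
  | Const d k => [:: Const (32 + d) k; Op OpAnd (32 + d) (32 + d) rMask]
  | Op o d a b =>
      [:: Op o (32 + d) (32 + a) (32 + b); Op OpAnd (32 + d) (32 + d) rMask]
  | Read d a =>
      [:: Op OpAdd tb (32 + a) rS; Read tb tb; Op OpEq tb tb rQ;
          Op OpMul tb tb rG; Op OpAdd tb tb (32 + a); Op OpAdd tb tb rW;
          Read (32 + d) tb]
  | Write a b =>
      [:: Op OpAdd tb (32 + a) rS; Write tb rQ; Op OpAdd tb (32 + a) rW;
          Op OpAdd tb tb rG; Write tb (32 + b)]
  | Rand d => [:: Rand (32 + d); Op OpAnd (32 + d) (32 + d) rMask]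
  | Jump l => [:: Jump (sim_label l)]
  | JumpIfZero a l => [:: JumpIfZero (32 + a) (sim_label l)]
  end%N.

(** All blocks have length 8, the seven instructions of a simulated [Read] and a jump, so that jump
    targets are computed by a multiplication. *)
Definition sim_block (l : nat) : seq instr :=
  let s := sim_body (nth (Jump 0) p l) in
  s ++ nseq (8 - size s) (Jump (sim_label l.+1)).

Definition sim_code : seq instr :=
  mkseq (fun k => nth (Jump 0) (sim_block (k %/ 8)) (k %% 8)) (8 * size p).

Lemma size_sim_code : size sim_code = (8 * size p)%N.
Proof. exact: size_mkseq. Qed.

Lemma size_sim_block l : size (sim_block l) = 8%N.
Proof. by rewrite size_cat size_nseq; case: (nth _ _ _). Qed.

Lemma code_at_sim_block P l : code_at P off sim_code -> (l < size p)%N ->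
  code_at P (off + 8 * l) (sim_block l).
Proof.
move=> cP lp; have [sz _] := cP; rewrite size_sim_code in sz.
split => [|j]; rewrite size_sim_block; [lia|move=> j8].
rewrite -addnA (code_at_nth _ cP) ?size_sim_code; last lia.
rewrite nth_mkseq; last lia.
by rewrite mulnC divnMDl// divn_small// addn0 modnMDl modn_small.
Qed.

End SimCode.

Definition regs_below (m : nat) (i : instr) : bool :=
  match i with
  | Const d _ => d < m
  | Op _ d a b => [&& d < m, a < m & b < m]
  | Read d a => (d < m) && (a < m)
  | Write a b => (a < m) && (b < m)
  | Rand d => d < m
  | Jump _ => true
  | JumpIfZero a _ => a < m
  end%N.

Section Simulation.
Variables (w w' m off : nat) (p P : program).
Hypothesis w_gt0 : (0 < w)%N.
Hypothesis ww' : (w.+2 <= w')%N.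
Hypothesis p_regs : all (regs_below m) p.
Let tb := (32 + m)%N.
Hypothesis P_code : code_at P off (sim_code tb off p).
Let W := (2 ^ w)%N.
Variables (R0 M0 : nat -> nat) (q g : nat).
Hypothesis R0W : R0 rW = W.
Hypothesis R0S : R0 rS = (2 * W)%N.
Hypothesis R0mask : R0 rMask = (W - 1)%N.
Hypothesis R0Q : R0 rQ = q.
Hypothesis R0G : R0 rG = g.
Hypothesis gE : g = 0%N \/ g = (2 * W)%N.

(** Registers below 32 belong to the outer program. Tying them to their values [R0] at the start of
    the phase gives them back to the outer program when the phase ends. *)
Definition sim_regs (R RC : nat -> nat) : Prop :=
  [/\ forall d, (d < m)%N -> RC (32 + d)%N = R d,
      forall d, (d < m)%N -> (R d < W)%N
    & forall r, (r < 32)%N -> RC r = R0 r].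

(* The cell [a] of the simulated memory is kept at [W + a], or at [W + g + a]
   if the stamp at [2 W + a] equals [q]. For [g = 2 W] all writes thus go to
   an overlay, and the block starting at [W] survives. *)
Definition sim_mem (M MC : nat -> nat) : Prop :=
  [/\ forall a, (a < W)%N -> M a = MC (a + W + (MC (a + 2 * W)%N == q) * g)%N,
      forall a, (a < W)%N -> (M a < W)%N,
      forall i, (i < W)%N || (i < 2 * W)%N && (g != 0%N) -> MC i = M0 i
    & forall a, (a < W)%N ->
        MC (a + 2 * W)%N = M0 (a + 2 * W)%N \/ MC (a + 2 * W)%N = q].

Definition sim (c C : config) : Prop :=
  [/\ pc C = sim_label off p (pc c), sim_regs (regs c) (regs C)
    & sim_mem (memory c) (memory C)].

Lemma W_gt0 : (0 < W)%N. Proof. by rewrite expn_gt0. Qed.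

(** The outer memory has four regions of [W] cells: the input, the index, the stamps and the
    overlay. Two additional address bits make room for them. *)
Lemma W4_le : (4 * W <= 2 ^ w')%N.
Proof. by rewrite -(expnD 2 2) leq_exp2l. Qed.

Lemma sim_regs_upd R RC d v : sim_regs R RC -> (v < W)%N ->
  sim_regs (upd R d v) (upd RC (32 + d) v).
Proof.
move=> [h1 h2 h3] vW; split => e em; rewrite /upd.
- by rewrite eqn_add2l; case: eqP => // _; exact: h1.
- by case: eqP => // _; exact: h2.
- by case: eqP => [|_]; [lia|exact: h3].
Qed.

Lemma sim_regs_tb R RC v : sim_regs R RC -> sim_regs R (upd RC tb v).
Proof.
move=> [h1 h2 h3]; split => // e em; rewrite /upd /tb.
- by case: eqP => [|_]; [lia|exact: h1].
- by case: eqP => [|_]; [lia|exact: h3].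
Qed.

Lemma upd_same (f : nat -> nat) a v : upd f a v a = v.
Proof. by rewrite /upd eqxx. Qed.

Lemma upd_other (f : nat -> nat) a b v : a != b -> upd f b v a = f a.
Proof. by rewrite /upd => /negbTE ->. Qed.

Lemma upd_upd (f : nat -> nat) a v v' : upd (upd f a v) a v' = upd f a v'.
Proof. by apply/funext => i; rewrite /upd; case: eqP. Qed.

Lemma sim_mem_write M MC a v : sim_mem M MC -> (a < W)%N -> (v < W)%N ->
  sim_mem (upd M a v) (upd (upd MC (a + 2 * W) q) (a + W + g) v).
Proof.
move=> [h1 h2 h3 h4] aW vW; have W0 := W_gt0.
split => [b bW|b bW|i iW|b bW].
- have [->|ba] := eqVneq b a.
    rewrite upd_same (@upd_other _ (a + 2 * W)) ?upd_same; last by case: gE; lia.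
    by rewrite eqxx mul1n upd_same.
  rewrite upd_other// h1//.
  rewrite (@upd_other _ (b + 2 * W)); last by case: gE => ->; lia.
  rewrite (@upd_other _ (b + 2 * W)); last by lia.
  have bo : ((MC (b + 2 * W) == q) * g = 0 \/ (MC (b + 2 * W) == q) * g = g)%N.
    by case: (_ == _); rewrite ?mul0n ?mul1n; [right|left].
  rewrite upd_other; last by case: bo => ->; case: gE => gE'; lia.
  by rewrite upd_other//; case: bo => ->; case: gE => gE'; lia.
- by rewrite /upd; case: eqP => // _; exact: h2.
- rewrite upd_other; last by case: gE iW => ->; lia.
  by rewrite upd_other; [exact: h3|lia].
- rewrite upd_other; last by case: gE => ->; lia.
  have [->|ba] := eqVneq b a; first by rewrite upd_same; right.
  by rewrite upd_other; [exact: h4|lia].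
Qed.

Lemma sim_halted c C : sim c C -> halted p c ->
  pc C = (off + size (sim_code tb off p))%N.
Proof.
move=> [-> _ _] hc; rewrite size_sim_code /sim_label; congr (_ + 8 * _)%N.
exact/minn_idPr.
Qed.

Lemma sim_not_halted c C : sim c C -> ~~ halted p c -> ~~ halted P C.
Proof.
have [sz _] := P_code; rewrite size_sim_code in sz.
by move=> [pcE _ _]; rewrite /halted pcE /sim_label; lia.
Qed.

Lemma sim_block_run l s R M : (l < size p)%N ->
  sim_body tb off p (nth (Jump 0) p l) = s -> all is_simple s ->
  (size s < 8)%N ->
  det_run w' P (size s).+1 (Config (sim_label off p l) R M)
    (Config (sim_label off p l.+1) (foldl (exec_simple w') (R, M) s).1
                         (foldl (exec_simple w') (R, M) s).2).
Proof.
move=> lp bE ss s8; have cb := code_at_sim_block P_code lp.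
have -> : sim_label off p l = (off + 8 * l)%N by rewrite /sim_label; lia.
have [cb1 cb2] := code_at_cat cb; rewrite bE in cb1 cb2.
rewrite -addn1; apply: det_run_trans.
  exact: det_run_simple.
have [sz2 _] := cb2; apply: det_run_jump.
  by move: sz2; rewrite size_nseq; lia.
by rewrite -[X in nth _ _ X]addn0 (code_at_nth _ cb2) ?size_nseq ?subn_gt0//
  nth_nseq subn_gt0 s8.
Qed.

Lemma sim_step_simple c C : sim c C -> ~~ halted p c ->
  let i := nth (Jump 0) p (pc c) in is_simple i ->
  exists2 t, (t <= 7)%N &
    exists2 C', det_run w' P t.+1 C C' & sim (step w p 0 c) C'.
Proof.
case: c C => [l R M] [lC RC MC] [/= -> sR sM]; rewrite /halted/= -ltnNge => lp.
set i := nth _ _ _; have iE : nth (Jump l) p l = i by exact: set_nth_default.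
have iR : regs_below m i by have /all_nthP := p_regs; apply.
have W0 := W_gt0; have W4 := W4_le.
have ww : (0 < w <= w')%N by lia.
have [sR1 sR2 sR3] := sR; have [sM1 sM2 sM3 sM4] := sM.
have rtb r : (r < m)%N -> (32 + r)%N != tb by rewrite /tb; lia.
have run := @sim_block_run l _ RC MC lp erefl.
rewrite iE; rewrite -/i in run; move=> si.
case: i {iE} iR si run => //=.
- move=> d k dm _ /(_ isT isT) run; exists 2%N => //; eexists; first exact: run.
  split => //=; rewrite upd_same upd_upd (@upd_other _ 12%N) ?(sR3 12%N)//.
  rewrite R0mask land_mask modn_dvdm ?dvdn_exp2l//; last by lia.
  by apply: sim_regs_upd => //; rewrite ltn_mod.
- move=> o d a b /and3P[dm am bm] _ /(_ isT isT) run; exists 2%N => //.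
  eexists; first exact: run.
  split => //=; rewrite upd_same upd_upd (@upd_other _ 12%N) ?(sR3 12%N)//.
  rewrite R0mask !sR1// eval_op_mask ?sR2//.
  by apply: sim_regs_upd => //; apply: eval_op_lt; rewrite ?sR2.
- move=> d a /andP[dm am] _ /(_ isT isT) run; exists 7%N => //.
  eexists; first exact: run.
  split => //=; rewrite !(upd_same, upd_upd) !(@upd_other _ (32 + a)%N) ?rtb//.
  rewrite !(@upd_other _ 10%N) ?(@upd_other _ 13%N) ?(@upd_other _ 14%N)// ?(sR3 10%N)//
    ?(sR3 11%N)// ?(sR3 13%N)// ?(sR3 14%N)//.
  rewrite R0W R0S R0Q R0G sR1//.
  have aW := sR2 _ am.
  rewrite (@modn_small (_ + 2 * W)) ?(@modn_small (_ * g)); last 2 first.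
  - by case: (_ == _); case: gE => ->; lia.
  - by lia.
  rewrite (@modn_small (_ + R a)); last by case: (_ == _); case: gE => ->; lia.
  rewrite modn_small; last by case: (_ == _); case: gE => ->; lia.
  rewrite -addnA addnC -sM1//.
  by apply: sim_regs_upd; [exact: sim_regs_tb|exact: sM2].
- move=> a b /andP[am bm] _ /(_ isT isT) run; exists 5%N => //.
  eexists; first exact: run.
  split => //=; rewrite !(upd_same, upd_upd) ?(@upd_other _ (32 + _)%N) ?rtb//.
    exact: sim_regs_tb.
  rewrite !(@upd_other _ 10%N) ?(@upd_other _ 13%N) ?(@upd_other _ 14%N)// ?(sR3 10%N)//
    ?(sR3 11%N)// ?(sR3 13%N)// ?(sR3 14%N)//.
  rewrite R0W R0S R0Q R0G !sR1//.
  have aW := sR2 _ am; have bW := sR2 _ bm.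
  rewrite (@modn_small (_ + 2 * W)); last by lia.
  rewrite (@modn_small (_ + W)); last by lia.
  rewrite modn_small; last by case: gE => ->; lia.
  exact: sim_mem_write.
Qed.

(** A random draw is always the first outer instruction of its block, so it can be coupled with its
    residue modulo [2 ^ w]; the at most seven steps after it are deterministic. *)
Lemma sim_step c C : sim c C -> ~~ halted p c ->
  exists2 t, (t <= 7)%N &
    forall r, (r < 2 ^ w')%N ->
    exists2 C', det_run w' P t (step w' P r C) C'
              & sim (step w p (r %% 2 ^ w)%N c) C'.
Proof.
move=> s hc; have hC := sim_not_halted s hc.
have [ss|] := boolP (is_simple (nth (Jump 0) p (pc c))).
  have [t t7 [C' [h1 h2 h3] s']] := sim_step_simple s hc ss.
  exists t => // r _; exists C'; first by rewrite step_det.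
  rewrite step_det//; have -> : nth (Jump (pc c)) p (pc c) = nth (Jump 0) p (pc c).
    by apply: set_nth_default; rewrite ltnNge.
  by case: (nth _ _ _) ss.
case: c C s hc hC => [l R M] [lC RC MC] [/= -> sR sM].
rewrite /halted/= -!ltnNge => lp lP.
set i := nth _ _ _; have iE : nth (Jump l) p l = i by exact: set_nth_default.
have iR : regs_below m i by have /all_nthP := p_regs; apply.
have cb := code_at_sim_block P_code lp.
have lE : sim_label off p l = (off + 8 * l)%N by rewrite /sim_label; lia.
have nP j : (j < 8)%N -> nth (Jump (sim_label off p l)) P (sim_label off p l + j) =
    nth (Jump 0) (sim_block tb off p l) j.
  by move=> j8; rewrite lE (code_at_nth _ cb) ?size_sim_block.
have := nP 0%N isT; rewrite addn0 => ->; rewrite iE /sim_block -/i => ni.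
have [sR1 sR2 sR3] := sR.
have iE0 : nth (Jump 0) p l = i by [].
case: i iE iR ni iE0 => //= [d|l'|a l'] iE iR _ iE0.
- exists 2%N => // r _.
  exists (Config (sim_label off p l.+1) (upd RC (32 + d) (r %% 2 ^ w)%N) MC);
    last first.
    by split => //=; apply: (sim_regs_upd _ sR); rewrite ltn_mod expn_gt0.
  rewrite lE in lP *.
  have [sz _] := cb; rewrite size_sim_block in sz.
  have cb1 : code_at P (off + 8 * l).+1 [:: Op OpAnd (32 + d) (32 + d) rMask].
    split => /=; first lia.
    case=> // _; rewrite addn0 -addn1 (code_at_nth _ cb) ?size_sim_block//.
    by rewrite /sim_block iE0.
  have := @det_run_simple w' P _ _ (upd RC (32 + d) r) MC cb1 isT.
  rewrite /= upd_same upd_upd (@upd_other _ 12%N) ?(sR3 12%N)//.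
  rewrite R0mask land_mask => run1.
  rewrite -[2%N]/(1 + 1)%N; apply: det_run_trans; first exact: run1.
  apply: det_run_jump; first lia.
  rewrite addn1 -addn2 (code_at_nth _ cb) ?size_sim_block// /sim_block.
  by rewrite iE0.
- by exists 0%N => // r _; eexists; first exact: erefl.
- have nP1 := nP 1%N isT.
  have e0 : (RC (32 + a)%N == 0%N) = (R a == 0%N) by rewrite sR1.
  have [Ra|Ra] := boolP (R a == 0%N).
    exists 0%N => // r _; eexists; first exact: erefl.
    by split => //=; rewrite e0 Ra.
  exists 1%N => // r _; exists (Config (sim_label off p l.+1) RC MC);
    last by split => //=; rewrite (negbTE Ra).
  rewrite e0 (negbTE Ra); apply: det_run_jump.
    by have [sz _] := cb; rewrite size_sim_block in sz; lia.
  have [sz _] := cb; rewrite size_sim_block in sz.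
  rewrite lE -addn1 (code_at_nth _ cb) ?size_sim_block// /sim_block.
  by rewrite iE0.
Qed.

Section SimExpect.
Variable RR : realType.
Local Open Scope ereal_scope.

(** [F] bounds the time of everything that happens after the simulated run, as a function of its
    final configuration. In this form the estimates of successive phases compose. *)
Lemma sim_expected_time (F : config -> \bar RR) :
  (forall c, 0 <= F c) ->
  (forall c C, sim c C -> halted p c -> expected_time RR w' P C <= F c) ->
  forall c C, sim c C -> expected_time RR w' P C <=
    8%:R%:E * expected_time RR w p c + halt_expect w p F c.
Proof.
move=> F0 HF c C s; apply: ge_ereal_sup => _ [k _ <-].
have rhs0 c' : 0 <= 8%:R%:E * expected_time RR w p c' + halt_expect w p F c'.
  by rewrite adde_ge0 ?halt_expect_ge0// mule_ge0 ?expected_time_ge0.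
elim: k c C s => [|k IHk] c C s.
  by rewrite /= if_same; exact: rhs0.
have [hc|hc] := boolP (halted p c).
  apply: (@le_trans _ _ (expected_time RR w' P C)).
    exact: truncated_time_le.
  apply: (le_trans (HF _ _ s hc)).
  by rewrite expected_time_halted// mule0 add0e halt_expect_halted.
have hC := sim_not_halted s hc; have [t t7 st] := sim_step s hc.
(* The truncation is deepened so that exactly [k] steps remain once the [t.+1] outer steps for one
   inner step are done. *)
apply: (@le_trans _ _ (truncated_time RR w' P (t + k).+1 C)).
  by apply: nondecreasing_truncated_time; rewrite ?leEnat ltnS leq_addl.
rewrite /= (negbTE hC).
set G := fun c' => 8%:R%:E * expected_time RR w p c' + halt_expect w p F c'.
apply: (@le_trans _ _ (1 + average w'
    (fun r => t%:R%:E + G (step w p (r %% 2 ^ w)%N c)))).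
  rewrite leeD2l//; apply: le_average => r /st[C' run s'].
  by rewrite (det_run_truncated _ _ run) leeD2l// IHk.
rewrite averageD => [|r|r]; [|by rewrite lee_fin|exact: rhs0].
rewrite (@average_modn _ w w' (fun r => G (step w p r c)));
  [|lia|by move=> r; exact: rhs0].
rewrite average_cst addeA /G averageD => [|r|r]; last 2 first.
- by rewrite mule_ge0 ?expected_time_ge0.
- exact: halt_expect_ge0.
rewrite averageZ => [|r]; last exact: expected_time_ge0.
rewrite -halt_expect_step// addeA leeD2r//.
apply: (@le_trans _ _ (8%:R%:E * (1 + average w
    (fun r => expected_time RR w p (step w p r c))))).
  rewrite ge0_muleDr//; last by apply: average_ge0 => r _; exact: expected_time_ge0.
  by rewrite mule1 leeD2r// -EFinD lee_fin nat1r ler_nat.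
by rewrite lee_wpmul2l// expected_time_step.
Qed.

(** The counterpart for success probabilities: here [F] bounds from below what the rest of the outer
    run achieves. *)
Lemma sim_halt_expect (F G : config -> \bar RR) :
  (forall c, 0 <= F c) -> (forall c, 0 <= G c) ->
  (forall c C, sim c C -> halted p c -> F c <= halt_expect w' P G C) ->
  forall c C, sim c C -> halt_expect w p F c <= halt_expect w' P G C.
Proof.
move=> F0 G0 HF c C s; apply: ge_ereal_sup => _ [k _ <-].
elim: k c C s => [|k IHk] c C s /=; case: ifP => hc; do ?exact: HF.
  exact: halt_expect_ge0.
have hC := sim_not_halted s (negbT hc).
have [t t7 st] := sim_step s (negbT hc).
rewrite [leRHS]halt_expect_step//.
rewrite -(@average_modn _ w w'); [|lia|]; last first.
  by move=> r; exact: halt_expect_within_ge0.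
apply: le_average => r /st[C' run s'].
by rewrite (det_run_expect _ run)// IHk.
Qed.

End SimExpect.

End Simulation.

(** * A small imperative language on top of the machine *)

Inductive expr :=
  | Var (r : nat)
  | Cst (k : nat)
  | Bin (o : binop) (e1 e2 : expr)
  | Mem (e : expr).

Inductive cmd :=
  | Skip
  | Assign (d : nat) (e : expr)
  | Store (e1 e2 : expr)
  | Seq (c1 c2 : cmd)
  | While (e : expr) (c : cmd).

Fixpoint eval (w : nat) (st : state) (e : expr) : nat :=
  match e with
  | Var r => st.1 r
  | Cst k => (k %% 2 ^ w)%N
  | Bin o e1 e2 => eval_op w o (eval w st e1) (eval w st e2)
  | Mem e => st.2 (eval w st e)
  end.

(* The value of [e] ends up in register [t]; registers above [t] are scratch. *)
Fixpoint compile_expr (t : nat) (e : expr) : seq instr :=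
  match e with
  | Var r => [:: Op OpOr t r r]
  | Cst k => [:: Const t k]
  | Bin o e1 e2 =>
      compile_expr t e1 ++ compile_expr t.+1 e2 ++ [:: Op o t t t.+1]
  | Mem e => compile_expr t e ++ [:: Read t t]
  end.

Fixpoint expr_size (e : expr) : nat :=
  match e with
  | Var _ | Cst _ => 1
  | Bin _ e1 e2 => expr_size e1 + expr_size e2 + 1
  | Mem e => expr_size e + 1
  end%N.

Fixpoint cmd_size (c : cmd) : nat :=
  match c with
  | Skip => 0
  | Assign _ e => expr_size e + 1
  | Store e1 e2 => expr_size e1 + expr_size e2 + 1
  | Seq c1 c2 => cmd_size c1 + cmd_size c2
  | While e c => expr_size e + 1 + cmd_size c + 1
  end%N.

Fixpoint compile (tb off : nat) (c : cmd) : seq instr :=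
  match c with
  | Skip => [::]
  | Assign d e => compile_expr tb e ++ [:: Op OpOr d tb tb]
  | Store e1 e2 =>
      compile_expr tb e1 ++ compile_expr tb.+1 e2 ++ [:: Write tb tb.+1]
  | Seq c1 c2 => compile tb off c1 ++ compile tb (off + cmd_size c1) c2
  | While e c =>
      compile_expr tb e ++ [:: JumpIfZero tb (off + cmd_size (While e c))]
      ++ compile tb (off + expr_size e + 1) c ++ [:: Jump off]
  end%N.

Fixpoint expr_below (tb : nat) (e : expr) : bool :=
  match e with
  | Var r => (r < tb)%N
  | Cst _ => true
  | Bin _ e1 e2 => expr_below tb e1 && expr_below tb e2
  | Mem e => expr_below tb e
  end.

Fixpoint cmd_below (tb : nat) (c : cmd) : bool :=
  match c with
  | Skip => true
  | Assign d e => (d < tb)%N && expr_below tb e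
  | Store e1 e2 => expr_below tb e1 && expr_below tb e2
  | Seq c1 c2 => cmd_below tb c1 && cmd_below tb c2
  | While e c => expr_below tb e && cmd_below tb c
  end.

(** The number is the exact count of machine steps of the compiled code; upper bounds enter only
    with [wp]. *)
Inductive exec (w : nat) : cmd -> state -> nat -> state -> Prop :=
  | ExecSkip st : exec w Skip st 0 st
  | ExecAssign d e st :
      exec w (Assign d e) st (expr_size e + 1) (upd st.1 d (eval w st e), st.2)
  | ExecStore e1 e2 st :
      exec w (Store e1 e2) st (expr_size e1 + expr_size e2 + 1)
        (st.1, upd st.2 (eval w st e1) (eval w st e2))
  | ExecSeq c1 c2 st1 st2 st3 t1 t2 :
      exec w c1 st1 t1 st2 -> exec w c2 st2 t2 st3 ->
      exec w (Seq c1 c2) st1 (t1 + t2) st3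
  | ExecWhileStop e c st : eval w st e = 0%N ->
      exec w (While e c) st (expr_size e + 1) st
  | ExecWhileLoop e c st1 st2 st3 t1 t2 : eval w st1 e <> 0%N ->
      exec w c st1 t1 st2 -> exec w (While e c) st2 t2 st3 ->
      exec w (While e c) st1 (expr_size e + 1 + t1 + 1 + t2) st3.

Lemma size_compile_expr t e : size (compile_expr t e) = expr_size e.
Proof.
by elim: e t => //= [op e1 IH1 e2 IH2|e IHe] t; rewrite !size_cat ?IH1 ?IH2 ?IHe
  ?addnA.
Qed.

Lemma size_compile tb off c : size (compile tb off c) = cmd_size c.
Proof.
elim: c off => //= [d e|e1 e2|c1 IH1 c2 IH2|e c IHc] off;
  rewrite !size_cat ?size_compile_expr ?IH1 ?IH2 ?addnA//=.
by rewrite size_cat IHc /=; lia.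
Qed.

Lemma compile_expr_simple t e : all is_simple (compile_expr t e).
Proof.
by elim: e t => //= [op e1 IH1 e2 IH2|e IHe] t; rewrite !all_cat ?IH1 ?IH2 ?IHe.
Qed.

Section CompileCorrect.
Variables (w tb : nat).

Definition agree (R RC : nat -> nat) : Prop :=
  forall r, (r < tb)%N -> RC r = R r.

Lemma compile_exprP e t R RC M : agree R RC -> (tb <= t)%N ->
  expr_below tb e ->
  let st := foldl (exec_simple w) (RC, M) (compile_expr t e) in
  [/\ st.2 = M, st.1 t = eval w (R, M) e
    & forall r, (r < t)%N -> st.1 r = RC r].
Proof.
elim: e t RC => /= [r|k|op e1 IH1 e2 IH2|e IHe] t RC ag tbt.
- move=> rb; split => //; first by rewrite upd_same ag// PeanoNat.Nat.lor_diag.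
  by move=> r' r't; rewrite upd_other//; lia.
- by split => //; rewrite ?upd_same// => r' r't; rewrite upd_other//; lia.
- move=> /andP[b1 b2]; rewrite !foldl_cat.
  have := IH1 t RC ag tbt b1; case: (foldl _ _ _) => R1 M1 /= [-> v1 f1].
  have ag1 : agree R R1 by move=> r rb; rewrite f1 ?ag//; lia.
  have := IH2 t.+1 R1 ag1 (leqW tbt) b2.
  case: (foldl _ _ _) => R2 M2 /= [-> v2 f2].
  rewrite upd_same v2 f2// v1; split => // r rt.
  by rewrite upd_other ?f2 ?f1//; lia.
- move=> b; rewrite foldl_cat.
  have := IHe t RC ag tbt b; case: (foldl _ _ _) => R1 M1 /= [-> v1 f1].
  rewrite upd_same v1; split => // r rt.
  by rewrite upd_other ?f1//; lia.
Qed.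

Lemma agree_upd R RC d v : agree R RC -> agree (upd R d v) (upd RC d v).
Proof. by move=> ag r rb; rewrite /upd; case: eqP => // _; exact: ag. Qed.

Lemma run_expr p l e t R RC M : code_at p l (compile_expr t e) ->
  agree R RC -> (tb <= t)%N -> expr_below tb e ->
  exists RC', [/\ det_run w p (expr_size e) (Config l RC M)
                    (Config (l + expr_size e) RC' M),
                  RC' t = eval w (R, M) e
                & forall r, (r < t)%N -> RC' r = RC r].
Proof.
move=> cp ag tbt eb.
have := det_run_simple w RC M cp (compile_expr_simple t e).
have := compile_exprP M ag tbt eb; case: (foldl _ _ _) => R1 M1 /= [-> v1 f1].
by rewrite size_compile_expr => run; exists R1.
Qed.

Lemma compileP c st t st' : exec w c st t st' -> cmd_below tb c ->
  forall p off RC, code_at p off (compile tb off c) -> agree st.1 RC ->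
  exists2 RC', agree st'.1 RC' &
    det_run w p t (Config off RC st.2) (Config (off + cmd_size c) RC' st'.2).
Proof.
elim => {c st t st'}.
- by move=> st _ p off RC _ ag; exists RC => //=; rewrite addn0.
- move=> d e [R M] /= /andP[db eb] p off RC /code_at_cat[c1 c2] ag.
  have [R1 [run1 v1 f1]] := run_expr M c1 ag (leqnn _) eb.
  rewrite size_compile_expr in c2.
  have := det_run_simple w R1 M c2 isT => /= run2.
  exists (upd R1 d (eval w (R, M) e)).
    by apply: agree_upd => r rb; rewrite f1 ?ag.
  apply: det_run_trans run1 _.
  by move: run2; rewrite v1 PeanoNat.Nat.lor_diag -addnA.
- move=> e1 e2 [R M] /= /andP[b1 b2] p off RC /code_at_cat[c1].
  move=> /code_at_cat[c2 c3] ag; rewrite !size_compile_expr in c2 c3.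
  have [R1 [run1 v1 f1]] := run_expr M c1 ag (leqnn _) b1.
  have ag1 : agree R R1 by move=> r rb; rewrite f1 ?ag.
  have [R2 [run2 v2 f2]] := run_expr M c2 ag1 (leqnSn _) b2.
  have := det_run_simple w R2 M c3 isT => /= run3.
  exists R2; first by move=> r rb; rewrite f2 ?ag1//; lia.
  rewrite -addnA; apply: det_run_trans run1 _; apply: det_run_trans run2 _.
  by move: run3; rewrite v2 f2// v1 -!addnA.
- move=> c1 c2 st1 st2 st3 t1 t2 _ IH1 _ IH2 /= /andP[b1 b2] p off RC.
  move=> /code_at_cat[p1 p2] ag; rewrite size_compile in p2.
  have [R1 ag1 run1] := IH1 b1 p off RC p1 ag.
  have [R2 ag2 run2] := IH2 b2 p _ R1 p2 ag1.
  by exists R2 => //; apply: det_run_trans run1 _; rewrite addnA.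
- move=> e c [R M] /= e0 /andP[eb cb] p off RC /code_at_cat[p1].
  move=> /(@code_at_cat _ _ [:: _])[p2 _] ag.
  rewrite size_compile_expr in p2.
  have [R1 [run1 v1 f1]] := run_expr M p1 ag (leqnn _) eb.
  exists R1; first by move=> r rb; rewrite f1 ?ag.
  apply: det_run_trans run1 _; have [sz2 _] := p2.
  have := @det_run_jump_if_zero w p (off + expr_size e) tb
    (off + cmd_size (While e c)) R1 M.
  rewrite v1 e0 eqxx; apply; first by move: sz2 => /=; lia.
  by rewrite -[X in nth _ _ X]addn0 (code_at_nth _ p2).
- move=> e c [R M] st2 st3 t1 t2 /= e0 _ IH1 _ IH2 /= /andP[eb cb] p off RC cp ag.
  have /code_at_cat[p1 /(@code_at_cat _ _ [:: _])[p2 /code_at_cat[p3 p4]]] := cp.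
  rewrite !size_compile_expr size_compile /= in p2 p3 p4.
  have [R1 [run1 v1 f1]] := run_expr M p1 ag (leqnn _) eb.
  have ag1 : agree R R1 by move=> r rb; rewrite f1 ?ag.
  have [R2 ag2 run2] := IH1 cb p _ R1 p3 ag1.
  have [R3 ag3 run3] := IH2 (introT andP (conj eb cb)) p off R2 cp ag2.
  exists R3 => //; rewrite -!addnA.
  apply: det_run_trans run1 _.
  have [sz2 _] := p2; have [sz4 _] := p4; rewrite /= in sz2 sz4.
  apply: (@det_run_trans _ _ 1 _ _ (Config (off + expr_size e + 1) R1 M)).
    have := @det_run_jump_if_zero w p (off + expr_size e) tb
      (off + cmd_size (While e c)) R1 M.
    rewrite v1; case: eqP => // _; rewrite addn1; apply; first by lia.
    by rewrite -[X in nth _ _ X]addn0 (code_at_nth _ p2).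
  apply: det_run_trans run2 _; apply: det_run_trans; last first.
    by move: run3; rewrite -!addnA; exact.
  apply: det_run_jump; first by lia.
  by rewrite -[X in nth _ _ X]addn0 (code_at_nth _ p4).
Qed.

End CompileCorrect.

Definition wp (w : nat) (c : cmd) (T : nat) (Q : state -> Prop) (st : state)
    : Prop :=
  exists t st', [/\ exec w c st t st', (t <= T)%N & Q st'].

Section WeakestPreconditions.
Variable w : nat.

Lemma wp_mono c T T' (Q Q' : state -> Prop) st : (T <= T')%N ->
  (forall st, Q st -> Q' st) -> wp w c T Q st -> wp w c T' Q' st.
Proof.
move=> TT QQ [t [st' [e tT q]]]; exists t, st'; split => //; last exact: QQ.
exact: leq_trans TT.
Qed.

Lemma wp_skip (Q : state -> Prop) st : Q st -> wp w Skip 0 Q st.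
Proof. by move=> q; exists 0%N, st; split => //; exact: ExecSkip. Qed.

Lemma wp_assign d e (Q : state -> Prop) st :
  Q (upd st.1 d (eval w st e), st.2) ->
  wp w (Assign d e) (expr_size e + 1) Q st.
Proof. by move=> q; eexists _, _; split; first exact: ExecAssign. Qed.

Lemma wp_store e1 e2 (Q : state -> Prop) st :
  Q (st.1, upd st.2 (eval w st e1) (eval w st e2)) ->
  wp w (Store e1 e2) (expr_size e1 + expr_size e2 + 1) Q st.
Proof. by move=> q; eexists _, _; split; first exact: ExecStore. Qed.

Lemma wp_seq c1 c2 T1 T2 Q st : wp w c1 T1 (wp w c2 T2 Q) st ->
  wp w (Seq c1 c2) (T1 + T2) Q st.
Proof.
move=> [t1 [st1 [e1 tT1 [t2 [st2 [e2 tT2 q]]]]]]; exists (t1 + t2)%N, st2.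
by split => //; [exact: ExecSeq e1 e2|exact: leq_add].
Qed.

Lemma wp_while e c T (I : nat -> state -> Prop) k st :
  (forall k st, I k.+1 st -> eval w st e <> 0%N /\ wp w c T (I k) st) ->
  (forall st, I 0%N st -> eval w st e = 0%N) ->
  I k st ->
  wp w (While e c) (k * (T + expr_size e + 2) + expr_size e + 1) (I 0%N) st.
Proof.
move=> Istep Istop; elim: k st => [|k IHk] st.
  move=> I0; exists (expr_size e + 1)%N, st; split => //.
  by apply: ExecWhileStop; exact: Istop.
move=> /Istep[e0 [t1 [st1 [x1 tT1 /IHk[t2 [st2 [x2 tT2 q]]]]]]].
exists (expr_size e + 1 + t1 + 1 + t2)%N, st2; split => //.
  by apply: ExecWhileLoop; [exact: e0|exact: x1|exact: x2].
by rewrite mulSn; lia.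
Qed.

End WeakestPreconditions.

Definition block (cs : seq cmd) : cmd := foldr Seq Skip cs.

(** * The text *)

Definition lh : 'I_3 := @Ordinal 3 0 isT.
Definition la : 'I_3 := @Ordinal 3 1 isT.
Definition lb : 'I_3 := @Ordinal 3 2 isT.

Lemma prefix_catP (T : eqType) (u s1 s2 : seq T) : prefix u (s1 ++ s2) ->
  (prefix u s1 /\ u != s1) \/ exists2 v, u = s1 ++ v & prefix v s2.
Proof.
elim: s1 u => [|x s1 IHs] u /=; first by right; exists u.
case: u => [|y u] /=; first by left.
case: eqP => //= -> /IHs[[h1 h2]|[v -> h]]; [left|right; exists v => //].
by rewrite ?eqxx h1 eqseq_cons eqxx.
Qed.

Lemma prefix_nseqP (T : eqType) (u : seq T) k (x : T) : prefix u (nseq k x) ->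
  exists2 i, (i <= k)%N & u = nseq i x.
Proof.
elim: k u => [|k IHk] [|y u] //=; do ?by exists 0%N.
by case: eqP => //= -> /IHk[i ik ->]; exists i.+1.
Qed.

Lemma prefix_flattenP (T : eqType) (u : seq T) (ss : seq (seq T)) :
  prefix u (flatten ss) ->
  exists j v, [/\ (j <= size ss)%N, u = flatten (take j ss) ++ v
    & v = [::] \/ [/\ (j < size ss)%N, v != [::], prefix v (nth [::] ss j)
                     & v != nth [::] ss j]].
Proof.
elim: ss u => [|s ss IHss] u /=.
  by move=> u0; exists 0%N, [::]; split => //; [move: u0; case: u|left].
case/prefix_catP => [[us us']|[v -> /IHss[j [v' [jss -> h]]]]].
  exists 0%N, u; split => //; have [->|u0] := eqVneq u [::]; first by left.
  by right.
by exists j.+1, v'; split => //=; rewrite catA.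
Qed.

Definition block1 (p q : nat) : seq 'I_3 :=
  lh :: nseq (2 * p) la ++ nseq (2 * q) lb ++ [:: lh].

(** After a proper prefix the number of letters 0 is odd only at the third letter, where both other
    counts are odd; a prefix of [block1] never shows that combination, since its letters 1 are
    complete before the letters 2 begin. From then on the count of 1 or of 2 stays odd until the
    last letter. *)
Definition block2 (p q : nat) : seq 'I_3 :=
  [:: la; lb; lh; lh] ++ nseq (2 * p - 2) la ++ nseq (2 * q - 1) lb ++ [:: la].

(* The parities of the letter counts tell the proper prefixes of blocks of the
   two kinds apart, and both from complete blocks. *)
Definition parity1 (v : seq 'I_3) : bool :=
  odd (count_mem lh v) && ~~ (odd (count_mem la v) && odd (count_mem lb v)).

Definition all_even (v : seq 'I_3) : bool :=
  [&& ~~ odd (count_mem lh v), ~~ odd (count_mem la v)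
    & ~~ odd (count_mem lb v)].

Lemma block1_prefix p q v : prefix v (block1 p q) -> v != [::] ->
  v != block1 p q -> parity1 v.
Proof.
case: v => // x v /=; case: eqP => //= -> + _; rewrite /parity1 => pv.
rewrite eqseq_cons eqxx /= => vn; move: pv.
case/prefix_catP => [[/prefix_nseqP[i _ ->] _]|[v1 vE]].
  by rewrite /= !count_nseq /= ?(mul0n, mul1n) ?andbF.
case/prefix_catP => [[/prefix_nseqP[i _ v1E] _]|[v2 v1E p2]].
  by rewrite vE v1E /= !count_cat !count_nseq /= ?(mul0n, mul1n, addn0, add0n) ?oddM.
move: vn; rewrite vE v1E /= !eqseq_cat// !eqxx /=.
case: v2 p2 {v1E} => [|y [|? ?]] //= p2.
  by rewrite !count_cat !count_nseq /= ?(mul0n, mul1n, addn0, add0n) ?oddM.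
all: by move: p2; case: eqP => //= ->.
Qed.

Lemma block2_prefix p q v : (0 < q)%N ->
  prefix v (block2 p q) -> v != [::] ->
  v != block2 p q -> ~~ parity1 v && ~~ all_even v.
Proof.
move=> q0; rewrite /block2; case/prefix_catP => [|[v1 vE]].
  rewrite /parity1 /all_even.
  move=> -[pv nv] v0 _; move: pv nv v0.
  by case: v => [|? [|? [|? [|? [|? ?]]]]] //=; do 4?[case: eqP => //= ->].
case/prefix_catP => [[/prefix_nseqP[i _ v1E] _] _ _|[v2 v1E]].
  rewrite vE v1E /parity1 /all_even /= !count_nseq /= ?(mul0n, mul1n).
  by case: (odd i).
case/prefix_catP => [[/prefix_nseqP[i _ v2E] _] _ _|[v3 v2E]].
  rewrite vE v1E v2E /parity1 /all_even /= !count_cat !count_nseq /=.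
  rewrite ?(mul0n, mul1n, addn0, add0n) ?oddD ?oddM /=.
  have -> : odd (2 * p - 2) = false by lia.
  by case: (odd i).
move=> p3 _; rewrite vE v1E v2E !eqseq_cat// !eqxx /=.
case: v3 p3 {v2E} => [|y [|? ?]] //= p3; do 2?by move: p3; case: eqP => //= ->.
rewrite /parity1 /all_even /= !count_cat !count_nseq /= => _.
rewrite ?(mul0n, mul1n, addn0, add0n) ?oddD /=.
have -> : odd (2 * p - 2) = false by lia.
by have -> : odd (2 * q - 1) = true by lia.
Qed.

Section Text.
Variables (p q : nat -> nat).
Hypothesis p_gt0 : forall l, (0 < p l)%N.
Hypothesis q_gt0 : forall l, (0 < q l)%N.

Definition half1 n := flatten [seq block1 (p l) (q l) | l <- iota 0 n].
Definition half2 n := flatten [seq block2 (p l) (q l) | l <- iota 0 n].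

Definition half_count (x : 'I_3) (n : nat) : nat :=
  (2 * \sum_(l < n) nth 0 [:: 1; p l; q l] x)%N.

Lemma half1S n : half1 n.+1 = half1 n ++ block1 (p n) (q n).
Proof. by rewrite /half1 -[n.+1]addn1 iotaD map_cat flatten_cat /= cats0. Qed.

Lemma half2S n : half2 n.+1 = half2 n ++ block2 (p n) (q n).
Proof. by rewrite /half2 -[n.+1]addn1 iotaD map_cat flatten_cat /= cats0. Qed.

Lemma ord3P (P : 'I_3 -> Prop) : P lh -> P la -> P lb -> forall x, P x.
Proof.
move=> h0 h1 h2 [[|[|[|x]]] hx] //.
- by rewrite (_ : Ordinal hx = lh)//; exact: val_inj.
- by rewrite (_ : Ordinal hx = la)//; exact: val_inj.
- by rewrite (_ : Ordinal hx = lb)//; exact: val_inj.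
Qed.

Lemma count_half1 x n : count_mem x (half1 n) = half_count x n.
Proof.
rewrite /half_count; elim: n => [|n IHn]; first by rewrite big_ord0.
rewrite half1S count_cat IHn big_ord_recr /= mulnDr; congr (_ + _)%N.
by elim/ord3P: x {IHn}; rewrite /block1 /= !count_cat !count_nseq /=; lia.
Qed.

Lemma count_half2 x n : count_mem x (half2 n) = half_count x n.
Proof.
rewrite /half_count; elim: n => [|n IHn]; first by rewrite big_ord0.
rewrite half2S count_cat IHn big_ord_recr /= mulnDr; congr (_ + _)%N.
have := p_gt0 n; have := q_gt0 n.
by elim/ord3P: x {IHn}; rewrite /block2 /= !count_cat !count_nseq /=; lia.
Qed.

Lemma half_count_h n : half_count lh n = (2 * n)%N.
Proof. by rewrite /half_count /= sum1_card card_ord. Qed.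

Lemma half_count_even x n : odd (half_count x n) = false.
Proof. by rewrite /half_count oddM. Qed.

Lemma half1_prefixP n u : prefix u (half1 n) ->
  exists j v, [/\ (j <= n)%N, u = half1 j ++ v & v = [::] \/ parity1 v].
Proof.
case/prefix_flattenP => j [v [+ uE vP]]; rewrite size_map size_iota => jn.
exists j, v; split => //.
  by rewrite uE -map_take take_iota (minn_idPl jn).
case: vP => [->|[]]; first by left.
rewrite size_map size_iota => jn' v0 pv vn; right; move: pv vn.
by rewrite (nth_map 0%N) ?size_iota// nth_iota// => pv; exact: block1_prefix.
Qed.

Lemma half2_prefixP n u : prefix u (half2 n) ->
  exists j v, [/\ (j <= n)%N, u = half2 j ++ v
    & v = [::] \/ ~~ parity1 v && ~~ all_even v].
Proof.
case/prefix_flattenP => j [v [+ uE vP]]; rewrite size_map size_iota => jn.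
exists j, v; split => //.
  by rewrite uE -map_take take_iota (minn_idPl jn).
case: vP => [->|[]]; first by left.
rewrite size_map size_iota => jn' v0 pv vn; right; move: pv vn.
rewrite (nth_map 0%N) ?size_iota// nth_iota// => pv vn.
exact: (block2_prefix (q_gt0 _) pv v0 vn).
Qed.

(* More than [2 n] letters [lh] force the substring to start in the first half
   and to end in the second one. *)
Lemma text_infixP n k S' : (0 < k)%N -> infix S' (half1 n ++ half2 n) ->
  count_mem lh S' = (2 * (n + k))%N ->
  ~~ odd (count_mem la S') -> ~~ odd (count_mem lb S') ->
  exists2 j, (j + k <= n)%N & forall x,
    (count_mem x S' + half_count x j = half_count x n + half_count x (j + k))%N.
Proof.
move=> k0 /infixP[u [v' SE]] hS aS bS.
have hc := half_count_h n.
have cS x : (count_mem x (half1 n) + count_mem x (half2 n) =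
    count_mem x u + count_mem x S' + count_mem x v')%N.
  by rewrite -count_cat SE !count_cat addnA.
(* If [u] contained the whole first half, at most the [2 * n] letters [lh] of the second half would
   be left for [S']. *)
have pu : prefix u (half1 n).
  have : prefix u (half1 n ++ half2 n) by rewrite SE prefix_prefix.
  case/prefix_catP => [[]//|[u' uE _]]; have := cS lh.
  by rewrite uE count_cat count_half1 count_half2 hS hc; lia.
have [v vE pv] : exists2 v, u ++ S' = half1 n ++ v & prefix v (half2 n).
  have : prefix (u ++ S') (half1 n ++ half2 n) by rewrite SE catA prefix_prefix.
  case/prefix_catP => [[pS _]|//].
  have /prefixP[s /(congr1 (count_mem lh))] := pS.
  by rewrite !count_cat count_half1 hc hS; lia.
have [j [u1 [jn uE uP]]] := half1_prefixP pu.
have [i [v1 [iN viE vP]]] := half2_prefixP pv.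
have cE x : (half_count x j + count_mem x u1 + count_mem x S' =
    half_count x n + (half_count x i + count_mem x v1))%N.
  have /(congr1 (count_mem x)) := vE.
  by rewrite uE viE !count_cat !count_half1 count_half2.
(* Complete blocks and [S'] have even counts, so the partial blocks [u1] and [v1] agree in all
   parities. As [parity1] and [all_even] depend on parities only, both partial blocks must be
   empty. *)
have oE x : ~~ odd (count_mem x S') ->
    odd (count_mem x u1) = odd (count_mem x v1).
  move: (cE x) (half_count_even x j) (half_count_even x n) (half_count_even x i).
  by lia.
have oa := oE la aS; have ob := oE lb bS.
have oh : odd (count_mem lh u1) = odd (count_mem lh v1).
  by apply: oE; rewrite hS oddM.
have u1E : u1 = [::].
  case: uP => // pu1; case: vP => [v10|/andP[+ _]].
    by move: pu1; rewrite /parity1 oh v10.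
  by move: pu1; rewrite /parity1 oh oa ob => ->.
have v1E : v1 = [::].
  case: vP => // /andP[_]; rewrite /all_even -oh -oa -ob u1E //.
rewrite u1E v1E in cE.
have ijk : i = (j + k)%N.
  have := cE lh; rewrite hS !half_count_h /=; lia.
exists j; first by rewrite -ijk.
by move=> x; have := cE x; rewrite ijk /=; lia.
Qed.

Lemma text_infix n j k : (j + k <= n)%N -> exists2 S',
  infix S' (half1 n ++ half2 n) & forall x,
    (count_mem x S' + half_count x j = half_count x n + half_count x (j + k))%N.
Proof.
move=> jkn.
have half1_le m : (j <= m)%N -> exists s, half1 m = half1 j ++ s.
  elim: m => [|m IHm]; first by rewrite leqn0 => /eqP ->; exists [::].
  rewrite leq_eqVlt => /predU1P[<-|/IHm[s sE]]; first by exists [::]; rewrite cats0.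
  by exists (s ++ block1 (p m) (q m)); rewrite half1S sE catA.
have half2_le m : (j + k <= m)%N -> exists s, half2 m = half2 (j + k) ++ s.
  elim: m => [|m IHm]; first by rewrite leqn0 => /eqP ->; exists [::].
  rewrite leq_eqVlt => /predU1P[<-|/IHm[s sE]]; first by exists [::]; rewrite cats0.
  by exists (s ++ block2 (p m) (q m)); rewrite half2S sE catA.
have [s1 s1E] := half1_le n (leq_trans (leq_addr _ _) jkn).
have [s2 s2E] := half2_le n jkn.
exists (s1 ++ half2 (j + k)).
  by apply/infixP; exists (half1 j), s2; rewrite s1E s2E -!catA.
move=> x; have := count_half1 x n; rewrite s1E !count_cat count_half1 count_half2.
lia.
Qed.

Lemma size_half1 n :
  size (half1 n) = (\sum_(x < 3) half_count x n)%N.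
Proof.
elim: n => [|n IHn].
  by rewrite big1// => x _; rewrite /half_count big_ord0.
rewrite half1S size_cat IHn !big_ord_recr !big_ord0 /= /half_count !big_ord_recr.
by rewrite /block1 /= !size_cat !size_nseq /=; lia.
Qed.

Lemma size_half2 n : size (half2 n) = size (half1 n).
Proof.
elim: n => [|n IHn] //; rewrite half1S half2S !size_cat IHn; congr (_ + _)%N.
rewrite /block1 /block2 /= !size_cat !size_nseq /=.
by have := p_gt0 n; have := q_gt0 n; lia.
Qed.

End Text.

(** * Instances of Convolution-3SUM as block lengths, and the meaning of a query *)

Section Encoding.
Variables (n B : nat) (x : nat -> int).
Hypothesis x_small : small_instance n x.
Hypothesis nB : (n < B * B)%N.

(* [x i + B ^ 2], except that the value [0] at index [0] rules out the trivial
   solution [x k - x 0 = x k]. *)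
Definition shifted (i : nat) : nat :=
  if (0 < i <= n)%N then `|(x i + (B * B)%N%:Z)%R|%N else 0%N.

Definition digit1 (i : nat) : nat := (shifted i %/ B)%N.
Definition digit0 (i : nat) : nat := (shifted i %% B)%N.

(** Shifted values are below [2 * B ^ 2], hence all digits are below [2 * B], and [gap] keeps every
    block length positive and the natural subtractions exact. *)
Definition gap : nat := (2 * B + 1)%N.
Definition gap1 (l : nat) : nat := (gap + digit1 l.+1 - digit1 l)%N.
Definition gap0 (l : nat) : nat := (gap + digit0 l.+1 - digit0 l)%N.

Definition text : seq 'I_3 := half1 gap1 gap0 n ++ half2 gap1 gap0 n.

(* The queries for the difference [k] of indices come in pairs: [o] is the
   carry in [digit0 j + digit0 k = digit0 i + o * B]. *)
Definition query_vec (m : nat) : {ffun 'I_3 -> nat} :=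
  let k := (m.+1 %/ 2)%N in let o := (m %% 2)%N in
  [ffun c : 'I_3 => nth 0%N
    [:: 2 * (n + k);
        2 * (gap * (n + k) + digit1 n + digit1 k + o - B);
        2 * (gap * (n + k) + digit0 n + digit0 k - o * B)]%N c].

Lemma B_gt0 : (0 < B)%N. Proof. by case: B nB. Qed.

Lemma shiftedE i : (0 < i <= n)%N ->
  (shifted i)%:Z = x i + (B * B)%N%:Z.
Proof. by move=> ib; have := x_small ib; rewrite /shifted ib; lia. Qed.

Lemma shifted_lt i : (shifted i < 2 * (B * B))%N.
Proof.
have [ib|ib] := boolP (0 < i <= n)%N.
  by have := x_small ib; have := shiftedE ib; lia.
by rewrite /shifted (negbTE ib); move: nB; lia.
Qed.

Lemma digit1_lt i : (digit1 i < 2 * B)%N.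
Proof. by rewrite /digit1 ltn_divLR ?B_gt0// -mulnA; exact: shifted_lt. Qed.

Lemma digit0_lt i : (digit0 i < B)%N.
Proof. by rewrite ltn_mod B_gt0. Qed.

Lemma gap1_gt0 l : (0 < gap1 l)%N.
Proof. by rewrite /gap1 /gap; have := digit1_lt l; lia. Qed.

Lemma gap0_gt0 l : (0 < gap0 l)%N.
Proof. by rewrite /gap0 /gap; have := digit0_lt l; lia. Qed.

Lemma shifted0 : shifted 0 = 0%N. Proof. by []. Qed.

(** The block lengths are increments of [digit1] raised by [gap], so their sum telescopes; the digit
    at index 0 is 0. *)
Lemma half_count_a j :
  half_count gap1 gap0 la j = (2 * (gap * j + digit1 j))%N.
Proof.
rewrite /half_count /=; congr (2 * _)%N; elim: j => [|j IHj].
  by rewrite big_ord0 /digit1 shifted0 div0n muln0.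
rewrite big_ord_recr /= IHj /gap1 mulnS.
by have := digit1_lt j; rewrite /gap; lia.
Qed.

Lemma half_count_b j :
  half_count gap1 gap0 lb j = (2 * (gap * j + digit0 j))%N.
Proof.
rewrite /half_count /=; congr (2 * _)%N; elim: j => [|j IHj].
  by rewrite big_ord0 /digit0 shifted0 mod0n muln0.
rewrite big_ord_recr /= IHj /gap0 mulnS.
by have := digit0_lt j; rewrite /gap; lia.
Qed.

Lemma size_text :
  size text = (4 * n + 4 * (2 * gap * n + digit1 n + digit0 n))%N.
Proof.
rewrite /text size_cat (size_half2 gap1_gt0 gap0_gt0).
rewrite size_half1 !big_ord_recr big_ord0 /=.
rewrite (_ : widen_ord _ _ = lh); last exact: val_inj.
rewrite (_ : widen_ord _ _ = la); last exact: val_inj.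
rewrite (_ : ord_max = lb); last exact: val_inj.
rewrite half_count_h half_count_a half_count_b; lia.
Qed.

(** Numbers up to the length of the text fit in a word of the indexing algorithm, which makes these
    vectors legal queries. *)
Lemma query_vec_le m c : (0 < m <= 2 * n)%N -> (query_vec m c <= size text)%N.
Proof.
move=> mb; rewrite size_text /query_vec ffunE.
have kn : (m.+1 %/ 2 <= n)%N by lia.
have gkn : (gap * (m.+1 %/ 2) <= gap * n)%N by rewrite leq_mul2l kn orbT.
have gn : (gap <= gap * n)%N by rewrite leq_pmulr//; lia.
have := digit1_lt n; have := digit1_lt (m.+1 %/ 2)%N.
have := digit0_lt n; have := digit0_lt (m.+1 %/ 2)%N.
have o2 : (m %% 2 < 2)%N by rewrite ltn_mod.
have oB : (m %% 2 * B <= B)%N by case: (m %% 2)%N o2 => [|[|?]] //; lia.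
have gapE : gap = (2 * B + 1)%N by [].
have := mulnDr gap n (m.+1 %/ 2)%N; rewrite -mulnA => gE.
by elim/ord3P: c => /=; rewrite ?gE; move: gE;
  move: (gap * (m.+1 %/ 2))%N (gap * n)%N gkn gn oB;
  lia.
Qed.

(** Addition in base [B] with the carry [o]. The left side is the Convolution-3SUM equation: two
    shifts by [B * B] stand against one, and the surplus has digits [B] and 0, which explains the
    [- B] in the second entry of [query_vec]. *)
Lemma digits_sum i j k :
  ((shifted j + shifted k = shifted i + B * B)%N <->
   exists2 o, (o < 2)%N & (digit1 j + digit1 k + o = digit1 i + B)%N /\
     (digit0 j + digit0 k = digit0 i + o * B)%N).
Proof.
have B0 := B_gt0.
have XE l : shifted l = (digit1 l * B + digit0 l)%N by exact: divn_eq.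
have := digit0_lt i; have := digit0_lt j; have := digit0_lt k.
rewrite !XE; move: (digit1 i) (digit1 j) (digit1 k) => yi yj yk.
move: (digit0 i) (digit0 j) (digit0 k) => zi zj zk hk hj hi; split.
  move=> H; exists ((zi + B <= zj + zk) : nat)%N; first by case: (zi + B <= _)%N.
  have H' : ((yj + yk) * B + (zj + zk) = (yi + B) * B + zi)%N.
    by rewrite !mulnDl; lia.
  case: leqP => hB; rewrite ?mul1n ?mul0n.
    have {}H' : ((yj + yk).+1 * B + (zj + zk - B) = (yi + B) * B + zi)%N.
      by rewrite mulSn; lia.
    have lt1 : (zj + zk - B < B)%N by lia.
    have := congr1 (fun t => t %/ B)%N H'; have := congr1 (fun t => t %% B)%N H'.
    rewrite !modnMDl !divnMDl// !modn_small// !divn_small// !addn0.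
    by lia.
  have [lt1|ge1] := ltnP (zj + zk) B.
    have := congr1 (fun t => t %/ B)%N H'; have := congr1 (fun t => t %% B)%N H'.
    rewrite !modnMDl !divnMDl// !modn_small// !divn_small// !addn0.
    by lia.
  have {}H' : ((yj + yk).+1 * B + (zj + zk - B) = (yi + B) * B + zi)%N.
    by rewrite mulSn; lia.
  have lt1 : (zj + zk - B < B)%N by lia.
  have := congr1 (fun t => t %% B)%N H'.
  by rewrite !modnMDl !modn_small//; lia.
move=> [cy o2 [h1 h2]].
have : ((yj + yk + cy) * B + (zj + zk) = (yi + B) * B + zi + cy * B)%N.
  by rewrite h1 h2; lia.
by rewrite !mulnDl; lia.
Qed.

Lemma query_vecP m : (0 < m <= 2 * n)%N ->
  let k := (m.+1 %/ 2)%N in let o := (m %% 2)%N in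
  jumbled_occurs text (query_vec m) <->
  exists2 j, (j + k <= n)%N &
    (digit1 j + digit1 k + o = digit1 (j + k) + B)%N /\
    (digit0 j + digit0 k = digit0 (j + k) + o * B)%N.
Proof.
move=> mb k o; have o2 : (o < 2)%N by rewrite ltn_mod.
have k0 : (0 < k)%N by rewrite /k; lia.
have oB : (o * B <= B)%N by case: (o) o2 => [|[|?]] //; lia.
have gE : (gap * (n + k) = gap * n + gap * k)%N by rewrite mulnDr.
have gk : (gap <= gap * k)%N by rewrite leq_pmulr.
have gkE j : (gap * (j + k) = gap * j + gap * k)%N by rewrite mulnDr.
have hh := half_count_h gap1 gap0.
have ha := half_count_a; have hb := half_count_b.
have gB : (B <= gap)%N by rewrite /gap; lia.
split.
  move=> [S' iS /ffunP pS].
  have := pS lh; have := pS la; have := pS lb; rewrite !ffunE /= -/k -/o.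
  move=> cb ca ch.
  have oa : ~~ odd (count_mem la S') by rewrite ca oddM.
  have ob : ~~ odd (count_mem lb S') by rewrite cb oddM.
  have [j jk cE] := text_infixP gap1_gt0 gap0_gt0 k0 iS ch oa ob.
  exists j => //; have := cE la; have := cE lb.
  rewrite !ha !hb ca cb gE gkE; lia.
move=> [j jk [e1 e0]].
have [S' iS cE] := text_infix gap1_gt0 gap0_gt0 jk.
exists S' => //; apply/ffunP => c; rewrite !ffunE -/k -/o.
move: (cE c); move: (count_mem c S') => N; elim/ord3P: c => /=; rewrite ?hh ?ha ?hb ?gE ?gkE; lia.
Qed.

Lemma conv3sum_queries : conv3sum n x <->
  exists2 m, (0 < m <= 2 * n)%N & jumbled_occurs text (query_vec m).
Proof.
have BB : (0 < B * B)%N by rewrite muln_gt0 B_gt0.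
split.
  move=> [i [j [j0 ji iN xE]]]; pose k := (i - j)%N.
  have [sj sk si] : [/\ (0 < j <= n)%N, (0 < k <= n)%N & (0 < i <= n)%N].
    by rewrite /k; split; lia.
  have : (shifted j + shifted k = shifted i + B * B)%N.
    have := shiftedE sj; have := shiftedE sk; have := shiftedE si.
    by move: xE; rewrite -/k; lia.
  move=> /digits_sum[cy o2 [e1 e0]].
  (* This inverts the numbering of the queries, which sends [m] to the difference [m.+1 %/ 2] and
     the carry [m %% 2]. *)
  pose m := (2 * k - cy)%N.
  have mb : (0 < m <= 2 * n)%N by rewrite /m; lia.
  have mk : (m.+1 %/ 2)%N = k by rewrite /m; lia.
  have mo : (m %% 2)%N = cy by rewrite /m; lia.
  exists m => //; apply/(query_vecP mb); rewrite mk mo.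
  exists j; first by rewrite /k; lia.
  by have -> : (j + k)%N = i by rewrite /k; lia.
move=> [m mb /(query_vecP mb)]; set k := (m.+1 %/ 2)%N; set o := (m %% 2)%N.
move=> [j jk e]; have k0 : (0 < k)%N by rewrite /k; lia.
have o2 : (o < 2)%N by rewrite ltn_mod.
have /digits_sum sE : exists2 o, (o < 2)%N &
    (digit1 j + digit1 k + o = digit1 (j + k) + B)%N /\
    (digit0 j + digit0 k = digit0 (j + k) + o * B)%N by exists o.
(* A substring may start at the very beginning of the text; for [j = 0] the equation becomes
   [shifted k = shifted k + B * B], which is impossible. *)
have [j0|j0] := posnP j; first by move: sE; rewrite j0 add0n shifted0; lia.
exists (j + k)%N, j; split => //; first by lia.
rewrite addKn.
have sj : (0 < j <= n)%N by lia.
have sk : (0 < k <= n)%N by lia.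
have si : (0 < j + k <= n)%N by lia.
have := shiftedE sj; have := shiftedE sk; have := shiftedE si.
by lia.
Qed.

End Encoding.

(** * The reduction *)

Lemma exec_below w tb c st t st' : exec w c st t st' -> cmd_below tb c ->
  forall r, (tb <= r)%N -> st'.1 r = st.1 r.
Proof.
elim => {c st t st'} //=.
- by move=> d e [R M] /andP[db _] r tr; rewrite upd_other//; lia.
- move=> c1 c2 st1 st2 st3 t1 t2 _ IH1 _ IH2 /andP[b1 b2] r tr.
  by rewrite IH2// IH1.
- move=> e c st1 st2 st3 t1 t2 _ _ IH1 _ IH2 /andP[b1 b2] r tr.
  by rewrite IH2 ?b1// IH1.
Qed.

Arguments eval_op : simpl never.

(** * Evaluation of expressions without overflow *)

Section Arithmetic.
Variable w : nat.
Implicit Type st : state.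

Lemma eval_bin o e1 e2 v1 v2 st : eval w st e1 = v1 -> eval w st e2 = v2 ->
  eval w st (Bin o e1 e2) = eval_op w o v1 v2.
Proof. by move=> /= -> ->. Qed.

Lemma eval_add e1 e2 v1 v2 st : eval w st e1 = v1 -> eval w st e2 = v2 ->
  (v1 + v2 < 2 ^ w)%N -> eval w st (Bin OpAdd e1 e2) = (v1 + v2)%N.
Proof. by move=> h1 h2 h; rewrite (eval_bin _ h1 h2) /eval_op modn_small. Qed.

Lemma eval_sub e1 e2 v1 v2 st : eval w st e1 = v1 -> eval w st e2 = v2 ->
  (v2 <= v1 < 2 ^ w)%N -> eval w st (Bin OpSub e1 e2) = (v1 - v2)%N.
Proof.
move=> h1 h2 /andP[h h']; rewrite (eval_bin _ h1 h2) /eval_op.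
have -> : (v1 + (2 ^ w - v2) = 1 * 2 ^ w + (v1 - v2))%N by lia.
by rewrite modnMDl modn_small//; lia.
Qed.

Lemma eval_mul e1 e2 v1 v2 st : eval w st e1 = v1 -> eval w st e2 = v2 ->
  (v1 * v2 < 2 ^ w)%N -> eval w st (Bin OpMul e1 e2) = (v1 * v2)%N.
Proof. by move=> h1 h2 h; rewrite (eval_bin _ h1 h2) /eval_op modn_small. Qed.

Lemma eval_div e1 e2 v1 v2 st : eval w st e1 = v1 -> eval w st e2 = v2 ->
  eval w st (Bin OpDiv e1 e2) = (v1 %/ v2)%N.
Proof. by move=> h1 h2; rewrite (eval_bin _ h1 h2). Qed.

Lemma eval_lt e1 e2 v1 v2 st : eval w st e1 = v1 -> eval w st e2 = v2 ->
  eval w st (Bin OpLt e1 e2) = (v1 < v2)%N.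
Proof. by move=> h1 h2; rewrite (eval_bin _ h1 h2). Qed.

Lemma eval_cst k st : (k < 2 ^ w)%N -> eval w st (Cst k) = k.
Proof. by move=> kw; rewrite /= modn_small. Qed.

Lemma wp_assign_seq d e v c T Q R M : eval w (R, M) e = v ->
  wp w c T Q (upd R d v, M) ->
  wp w (Seq (Assign d e) c) (expr_size e + 1 + T) Q (R, M).
Proof. by move=> ev wc; apply: wp_seq; apply: wp_assign; rewrite ev. Qed.

Lemma wp_le c T T' Q st : (T <= T')%N -> wp w c T Q st -> wp w c T' Q st.
Proof. by move=> TT; exact: wp_mono. Qed.

End Arithmetic.

Local Notation "'V' r" := (Var r) (at level 9, r at level 8).
Declare Scope expr_scope.
Delimit Scope expr_scope with X.
Local Notation "a + b" := (Bin OpAdd a b) : expr_scope.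
Local Notation "a - b" := (Bin OpSub a b) : expr_scope.
Local Notation "a * b" := (Bin OpMul a b) : expr_scope.
Local Notation "a / b" := (Bin OpDiv a b) : expr_scope.
Local Notation "a < b" := (Bin OpLt a b) : expr_scope.

Ltac ev :=
  lazymatch goal with
  | |- eval _ _ (Bin OpAdd _ _) = _ => eapply eval_add; [ev|ev|]
  | |- eval _ _ (Bin OpSub _ _) = _ => eapply eval_sub; [ev|ev|]
  | |- eval _ _ (Bin OpMul _ _) = _ => eapply eval_mul; [ev|ev|]
  | |- eval _ _ (Bin OpDiv _ _) = _ => eapply eval_div; [ev|ev]
  | |- eval _ _ (Bin OpLt _ _) = _ => eapply eval_lt; [ev|ev]
  | |- eval _ _ (Cst _) = _ => eapply eval_cst
  | |- eval _ _ (Var _) = _ =>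
      rewrite /= /upd /=;
      first [match goal with |- ?f _ = _ => is_var f; eassumption end
            | reflexivity]
  | _ => idtac
  end.

(* Register 8 is the position where the next letter is written. *)
Definition emit (a : nat) (e : expr) : cmd :=
  Seq (Assign 9 e)
    (While (V 9) (block [:: Store (V 8) (Cst a); Assign 8 (V 8 + Cst 1)%X;
                            Assign 9 (V 9 - Cst 1)%X])).

Definition write_seq (M : nat -> nat) (a : nat) (s : seq nat) : nat -> nat :=
  fun i => if (a <= i < a + size s)%N then nth 0%N s (i - a) else M i.

Lemma write_seq0 M a : write_seq M a [::] = M.
Proof.
by apply/funext => i; rewrite /write_seq addn0; case: ifP => //; lia.
Qed.

Lemma write_seq_cat M a s1 s2 :
  write_seq (write_seq M a s1) (a + size s1) s2 = write_seq M a (s1 ++ s2).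
Proof.
apply/funext => i; rewrite /write_seq size_cat nth_cat.
case: (boolP (a + size s1 <= i < a + size s1 + size s2)%N) => h1.
  rewrite ifT; last by lia.
  by rewrite ifF; [congr (nth _ _ _); lia|lia].
case: (boolP (a <= i < a + size s1)%N) => h2.
  by rewrite ifT ?ifT//; lia.
by rewrite ifF//; lia.
Qed.

Lemma write_seq_rcons M a s v :
  upd (write_seq M a s) (a + size s) v = write_seq M a (rcons s v).
Proof.
rewrite -cats1 -write_seq_cat; apply/funext => i; rewrite /upd /write_seq /=.
case: eqP => [->|ne]; first by rewrite leqnn addn1 ltnS leqnn /= subnn.
by case: (boolP (a + size s <= i < a + size s + 1)%N) => // h; lia.
Qed.

Lemma write_seq_lt M a s i : (i < a)%N -> write_seq M a s i = M i.
Proof. by move=> ia; rewrite /write_seq leqNgt ia. Qed.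

Lemma upd_id (f : nat -> nat) a : upd f a (f a) = f.
Proof. by apply/funext => i; rewrite /upd; case: eqP => [->|]. Qed.

Lemma wp_emit w a e k R M T c Q : (a < 2 ^ w)%N -> (1 < 2 ^ w)%N ->
  eval w (R, M) e = k -> (k < 2 ^ w)%N -> (R 8%N + k < 2 ^ w)%N ->
  wp w c T Q (upd (upd R 9 0) 8 (R 8%N + k), write_seq M (R 8%N) (nseq k a)) ->
  wp w (Seq (emit a e) c) (18 * k + expr_size e + 3 + T) Q (R, M).
Proof.
move=> aw w1 ek kw pw wc.
pose I j (st : state) := exists2 i, (i + j)%N = k &
  st = (upd (upd R 9 j) 8 (R 8%N + i), write_seq M (R 8%N) (nseq i a)).
have wI : wp w (While (V 9) (block [:: Store (V 8) (Cst a);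
    Assign 8 (V 8 + Cst 1)%X; Assign 9 (V 9 - Cst 1)%X]))
    (k * (3 + 4 + 4 + 0 + 1 + 2) + 1 + 1) (I 0%N) (upd R 9 k, M).
  apply: (@wp_while _ (V 9) _ (3 + (4 + (4 + 0)))).
  - move=> j _ [i ijk ->]; split; first by rewrite /= /upd.
    apply: (wp_seq (T1 := 3)); apply: wp_store.
    apply: (wp_seq (T1 := 4)); apply: wp_assign.
    apply: (wp_seq (T1 := 4)); apply: wp_assign.
    apply: wp_skip; exists i.+1; first by lia.
    congr pair; last first.
      rewrite /= modn_small// {2 3}/upd /=.
      have := write_seq_rcons M (R 8%N) (nseq i a) a; rewrite size_nseq => ->.
      by rewrite -cats1 -(nseqD i 1) addn1.
    apply/funext => r; rewrite /= /upd /= /eval_op.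
    rewrite !(@modn_small 1)// !(@modn_small (R 8%N + i + 1)); last by lia.
    case: eqP => [->|_] /=.
      have -> : (j.+1 + (2 ^ w - 1) = 1 * 2 ^ w + j)%N by lia.
      by rewrite modnMDl modn_small//; lia.
    by case: eqP => // _; rewrite addn1 addnS.
  - by move=> _ [i _ ->]; rewrite /= /upd.
  - exists 0%N => //; congr pair; last by rewrite write_seq0.
    apply/funext => r; rewrite /= /upd addn0; case: (r =P 8%N) => [->//|//].
apply: (@wp_le _ _ (expr_size e + 1 + (k * 14 + 1 + 1) + T)); first by lia.
apply: wp_seq; apply: wp_seq; apply: wp_assign; rewrite /= ek.
apply: wp_mono wI => // _ [i ik ->]; move: ik; rewrite addn0 => ->.
exact: wc.
Qed.

(* Registers: 1 holds [n], 2 [B], 3 [gap B], 4 and 5 the digits of index [n],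
   6 the length of the text, 15 the index of the current block, 16 and 17 the
   digits of the previous one, 20 and 21 those of the current one, 22 the number
   of queries still to be asked, 23 the index difference and 24 the carry of the
   current query. *)
Definition load_digits (e : expr) : seq cmd :=
  [:: Assign 25 (Mem e + V 2 * V 2)%X; Assign 20 (V 25 / V 2)%X;
      Assign 21 (V 25 - V 20 * V 2)%X].

Definition emits1 : seq cmd :=
  [:: emit 0 (Cst 1); emit 1 (V 18); emit 2 (V 19); emit 0 (Cst 1)].

Definition emits2 : seq cmd :=
  [:: emit 1 (Cst 1); emit 2 (Cst 1); emit 0 (Cst 2); emit 1 (V 18 - Cst 2)%X;
      emit 2 (V 19 - Cst 1)%X; emit 1 (Cst 1)].

Definition pass_body (emits : seq cmd) : cmd :=
  block (load_digits (V 15) ++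
    [:: Assign 18 (Cst 2 * (V 3 + V 20 - V 16))%X;
        Assign 19 (Cst 2 * (V 3 + V 21 - V 17))%X] ++
    emits ++
    [:: Assign 16 (V 20); Assign 17 (V 21); Assign 15 (V 15 + Cst 1)%X]).

Definition pass (emits : seq cmd) : cmd :=
  block [:: Assign 15 (Cst 1); Assign 16 (Cst 0); Assign 17 (Cst 0);
            While (V 15 < V 1 + Cst 1)%X (pass_body emits)].

Lemma B_lt_gap B : (2 * B < gap B)%N.
Proof. by rewrite /gap; lia. Qed.

(** * Writing the two halves of the text *)

Section Passes.
Variables (n B : nat) (x : nat -> int).
Hypothesis n_gt0 : (0 < n)%N.
Hypothesis x_small : small_instance n x.
Hypothesis nB : (n < B * B)%N.
Hypothesis B_min : (B.-1 * B.-1 <= n)%N.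
Local Notation d1 := (digit1 n B x).
Local Notation d0 := (digit0 n B x).
Local Notation s := (size (text n B x)).
Lemma n_le_size : (4 * n <= s)%N.
Proof. by rewrite size_text//; lia. Qed.

Lemma gapM_le_size : (8 * (gap B * n) <= s)%N.
Proof. by rewrite size_text//; lia. Qed.

Lemma gap_le_size : (8 * gap B <= s)%N.
Proof.
apply: leq_trans gapM_le_size; rewrite leq_mul2l /=.
by rewrite leq_pmulr.
Qed.

(** Minimality of [B] gives [B * B <= n + 2 * B]. With all intermediate values measured against the
    length of the text, the one assumption [word_large] excludes overflow. *)
Lemma BB_le_size : (B * B <= s)%N.
Proof.
have := n_le_size; have := gap_le_size; rewrite /gap.
have : (B * B <= n + 2 * B)%N by case: (B) B_min => //= b; nia.
by lia.
Qed.

Variable w' : nat.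
Hypothesis word_large : (4 * s + 4 <= 2 ^ w')%N.

Definition input_cell (i : nat) : nat := `|(x i %% (2 ^ w')%N%:Z)%Z|%N.

Lemma eval_shifted e i R M : eval w' (R, M) e = i -> (0 < i <= n)%N ->
  M i = input_cell i -> R 2%N = B ->
  eval w' (R, M) (Mem e + V 2 * V 2)%X = shifted n B x i.
Proof.
move=> ei ib Mi R2; have BBs := BB_le_size.
have -> : eval w' (R, M) (Mem e + V 2 * V 2)%X =
    eval_op w' OpAdd (input_cell i) (B * B)%N.
  apply: eval_bin; first by rewrite /= ei.
  by apply: eval_mul => //; lia.
have xi := x_small ib; have sE := shiftedE x_small nB ib.
have sl := shifted_lt x_small nB i; have := n_le_size => ns.
have wl := word_large.
rewrite /eval_op /input_cell; set Z := (2 ^ w')%N in wl *.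
have [x0|x0] := lerP 0 (x i).
  rewrite modz_small; last by lia.
  by rewrite modn_small; lia.
rewrite -modzDr modz_small; last by lia.
have -> : (`|(x i + Z)%R| + B * B = 1 * Z + shifted n B x i)%N by lia.
by rewrite modnMDl modn_small//; lia.
Qed.

Lemma wp_load_digits e i R M c T Q : eval w' (R, M) e = i ->
  (0 < i <= n)%N -> M i = input_cell i -> R 2%N = B ->
  wp w' c T Q
    (upd (upd (upd R 25 (shifted n B x i)) 20 (d1 i)) 21 (d0 i), M) ->
  wp w' (foldr Seq c (load_digits e)) (expr_size e + 20 + T) Q (R, M).
Proof.
move=> ei ib Mi R2 wc.
have BBs := BB_le_size; have sl := shifted_lt x_small nB i.
have dE : shifted n B x i = (d1 i * B + d0 i)%N by exact: divn_eq.
apply: (@wp_le _ _ (expr_size (Mem e + V 2 * V 2)%X + 1 +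
   (expr_size (V 25 / V 2)%X + 1 +
   (expr_size (V 25 - V 20 * V 2)%X + 1 + T)))).
  by rewrite /=; lia.
rewrite [foldr _ _ _]/=.
apply: wp_assign_seq; first exact: eval_shifted ei ib Mi R2.
apply: wp_assign_seq; first by ev.
apply: (@wp_assign_seq _ _ _ (d0 i)); last exact: wc.
have -> : d0 i = (shifted n B x i - d1 i * B)%N by lia.
by ev; lia.
Qed.

Lemma upd98 R a b c d : upd (upd (upd (upd R 9 a) 8 b) 9 c) 8 d =
  upd (upd R 9 c) 8 d.
Proof. by apply/funext => r; rewrite /upd; case: eqP => //; case: eqP. Qed.

(** Common specification of the two block writers, so that [wp_pass] treats both halves of the text
    at once. *)
Definition emits_spec (emits : seq cmd) (bl : nat -> nat -> seq 'I_3) :=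
  forall R M p q cs T Q, (0 < p)%N -> (0 < q)%N ->
    R 18%N = (2 * p)%N -> R 19%N = (2 * q)%N ->
    (R 8%N + size (bl p q) < 2 ^ w')%N ->
    wp w' (block cs) T Q
      (upd (upd R 9 0) 8 (R 8%N + size (bl p q)),
       write_seq M (R 8%N) [seq nat_of_ord a | a <- bl p q]) ->
    wp w' (block (emits ++ cs)) (18 * size (bl p q) + 60 + T) Q (R, M).

Lemma emits1P : emits_spec emits1 block1.
Proof.
move=> R M p q cs T Q p0 q0 R18 R19.
have bE : [seq nat_of_ord a | a <- block1 p q] =
    [:: 0%N] ++ nseq (2 * p) 1%N ++ nseq (2 * q) 2%N ++ [:: 0%N].
  by rewrite /block1 /= !map_cat !map_nseq.
have sE : size (block1 p q) = (2 + 2 * p + 2 * q)%N.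
  by rewrite /block1 /= !size_cat !size_nseq /=; lia.
rewrite sE => pw wc.
apply: (@wp_le _ _ (18 * 1 + 1 + 3 + (18 * (2 * p) + 1 + 3 +
   (18 * (2 * q) + 1 + 3 + (18 * 1 + 1 + 3 + T))))); first by lia.
apply: (wp_emit (k := 1%N)); [lia|lia|by ev; lia|lia|lia|].
apply: (wp_emit (k := (2 * p)%N)); rewrite ?upd_same; [lia|lia|by ev|lia|lia|].
apply: (wp_emit (k := (2 * q)%N)); rewrite ?upd_same; [lia|lia|by ev|lia|lia|].
apply: (wp_emit (k := 1%N)); rewrite ?upd_same; [lia|lia|by ev; lia|lia|lia|].
have e : (R 8 + (2 + 2 * p + 2 * q) = R 8 + 1 + 2 * p + 2 * q + 1)%N by lia.
by move: wc; rewrite e !upd98 bE -!write_seq_cat !size_nseq; exact.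
Qed.

Lemma emits2P : emits_spec emits2 block2.
Proof.
move=> R M p q cs T Q p0 q0 R18 R19.
have bE : [seq nat_of_ord a | a <- block2 p q] =
    [:: 1%N] ++ [:: 2%N] ++ [:: 0%N; 0%N] ++
    nseq (2 * p - 2) 1%N ++ nseq (2 * q - 1) 2%N ++ [:: 1%N].
  by rewrite /block2 /= !map_cat !map_nseq.
have sE : size (block2 p q) = (2 + 2 * p + 2 * q)%N.
  by rewrite /block2 /= !size_cat !size_nseq /=; lia.
rewrite sE => pw wc.
apply: (@wp_le _ _ (18 * 1 + 1 + 3 + (18 * 1 + 1 + 3 + (18 * 2 + 1 + 3 +
   (18 * (2 * p - 2) + 3 + 3 + (18 * (2 * q - 1) + 3 + 3 +
   (18 * 1 + 1 + 3 + T))))))); first by lia.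
apply: (wp_emit (k := 1%N)); [lia|lia|by ev; lia|lia|lia|].
apply: (wp_emit (k := 1%N)); rewrite ?upd_same; [lia|lia|by ev; lia|lia|lia|].
apply: (wp_emit (k := 2%N)); rewrite ?upd_same; [lia|lia|by ev; lia|lia|lia|].
apply: (wp_emit (k := (2 * p - 2)%N)); rewrite ?upd_same;
  [lia|lia|by ev; lia|lia|lia|].
apply: (wp_emit (k := (2 * q - 1)%N)); rewrite ?upd_same;
  [lia|lia|by ev; lia|lia|lia|].
apply: (wp_emit (k := 1%N)); rewrite ?upd_same; [lia|lia|by ev; lia|lia|lia|].
have e : (R 8 + (2 + 2 * p + 2 * q) =
    R 8 + 1 + 1 + 2 + (2 * p - 2) + (2 * q - 1) + 1)%N by lia.
by move: wc; rewrite e !upd98 bE -!write_seq_cat !size_nseq; exact.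
Qed.

Definition scratch (r : nat) : bool :=
  [|| r == 8, r == 9, 15 <= r <= 21 | r == 25]%N.

Lemma wp_pass emits bl a0 R M c T Q : emits_spec emits bl ->
  let H l := flatten [seq bl (gap1 n B x j) (gap0 n B x j) | j <- iota 0 l] in
  (forall p q, (0 < p)%N -> (0 < q)%N -> size (bl p q) = 2 + 2 * p + 2 * q)%N ->
  (forall i, (0 < i <= n)%N -> M i = input_cell i) ->
  R 1%N = n -> R 2%N = B -> R 3%N = gap B -> R 8%N = a0 ->
  (n < a0)%N -> (a0 + size (H n) < 2 ^ w')%N ->
  (forall R', (forall r, ~~ scratch r -> R' r = R r) ->
    R' 8%N = (a0 + size (H n))%N ->
    wp w' c T Q (R', write_seq M a0 [seq nat_of_ord a | a <- H n])) ->
  wp w' (Seq (pass emits) c) (n * (126 * gap B + 500) + 50 + T) Q (R, M).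
Proof.
move=> eP H bS Mi R1 R2 R3 R8 na aw wc.
have HS l : H l.+1 = H l ++ bl (gap1 n B x l) (gap0 n B x l).
  by rewrite /H -[l.+1]addn1 iotaD map_cat flatten_cat /= cats0.
have Hle l : (l <= n)%N -> (size (H l) <= size (H n))%N.
  move=> ln; rewrite -(subnKC ln); elim: (n - l)%N => [|k IHk].
    by rewrite addn0.
  by rewrite addnS HS size_cat (leq_trans IHk)// leq_addr.
have gs := gap_le_size; have ns := n_le_size; have Bg := B_lt_gap B.
pose I k (st : state) := exists2 l, (l + k)%N = n &
  [/\ [/\ st.1 15%N = l.+1, st.1 16%N = d1 l & st.1 17%N = d0 l],
      st.1 8%N = (a0 + size (H l))%N,
      st.2 = write_seq M a0 [seq nat_of_ord a | a <- H l]
    & forall r, ~~ scratch r -> st.1 r = R r].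
have wI : wp w' (While (V 15 < V 1 + Cst 1)%X (pass_body emits))
    (n * (126 * gap B + 400 + 5 + 2) + 5 + 1) (I 0%N)
    (upd (upd (upd R 15 1) 16 0) 17 0, M).
  apply: (@wp_while _ (V 15 < V 1 + Cst 1)%X).
  - move=> k [R' M'] [l lk [[R15 R16 R17] R8' M'E fr]].
    rewrite /= in R15 R16 R17 R8' M'E fr.
    have R1' : R' 1%N = n by rewrite fr.
    have R2' : R' 2%N = B by rewrite fr.
    have R3' : R' 3%N = gap B by rewrite fr.
    have ln : (l < n)%N by lia.
    have dl := digit1_lt x_small nB l; have dl0 := digit0_lt x nB l.
    have dS := digit1_lt x_small nB l.+1; have dS0 := digit0_lt x nB l.+1.
    have g1 := gap1_gt0 x_small nB l; have g0 := gap0_gt0 x nB l.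
    have bsz := bS _ _ g1 g0; have := Hle _ ln; rewrite HS size_cat => Hl.
    (* The two gaps are below [gap B + 2 * B] and [gap B + B], and [2 * B < gap B]. At 18 steps per
       letter this accounts for the constant 126. *)
    have bmax : (size (bl (gap1 n B x l) (gap0 n B x l)) <= 7 * gap B + 2)%N.
      by rewrite bsz /gap1 /gap0; lia.
    split.
      have -> : eval w' (R', M') (V 15 < V 1 + Cst 1)%X = (l.+1 < n + 1)%N.
        by ev; lia.
      by rewrite addn1 ltnS ln.
    apply: (@wp_le _ _ (1 + 20 + (8 + (8 + (18 * size (bl (gap1 n B x l)
      (gap0 n B x l)) + 60 + (2 + (2 + (4 + 0)))))))); first by lia.
    apply: (@wp_load_digits _ l.+1) => //.
      by rewrite M'E write_seq_lt ?Mi//; lia.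
    apply: (@wp_assign_seq _ 18 _ (2 * gap1 n B x l)).
      by rewrite /gap1; ev; lia.
    apply: (@wp_assign_seq _ 19 _ (2 * gap0 n B x l)).
      by rewrite /gap0; ev; lia.
    apply: eP => //; first by rewrite /upd /= R8'; lia.
    apply: (@wp_assign_seq _ 16 _ (d1 l.+1)); first by ev.
    apply: (@wp_assign_seq _ 17 _ (d0 l.+1)); first by ev.
    apply: (@wp_assign_seq _ 15 _ l.+2).
      by rewrite -[l.+2]addn1; ev; lia.
    apply: wp_skip; exists l.+1; first by lia.
    split => //=.
    + by rewrite /upd /= R8' HS size_cat addnA.
    + rewrite /upd /= R8' M'E HS map_cat -write_seq_cat size_map.
      by [].
    + move=> r sr; rewrite -fr// /upd.
      by move: sr; rewrite /scratch; do !case: eqP => //=; lia.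
  - move=> [R' M'] [l lk [[R15 R16 R17] R8' M'E fr]].
    rewrite /= in R15 R16 R17 R8' M'E fr.
    have R1' : R' 1%N = n by rewrite fr.
    have -> : eval w' (R', M') (V 15 < V 1 + Cst 1)%X = (l.+1 < n + 1)%N.
      by ev; lia.
    by have -> : (l.+1 < n + 1)%N = false by lia.
  - exists 0%N => //; split => //=.
    + by rewrite /digit1 /digit0 shifted0 div0n mod0n.
    + by rewrite /upd /= R8 addn0.
    + by rewrite write_seq0.
    + by move=> r sr; rewrite /upd; move: sr; rewrite /scratch;
        do !case: eqP => //=; lia.
apply: (@wp_le _ _ ((2 + (2 + (2 + (n * (126 * gap B + 400 + 5 + 2) + 5 + 1 + 0))))
  + T)); first by rewrite !mulnDr; lia.
apply: wp_seq.
apply: (@wp_assign_seq _ 15 _ 1); first by ev; lia.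
apply: (@wp_assign_seq _ 16 _ 0); first by ev; lia.
apply: (@wp_assign_seq _ 17 _ 0); first by ev; lia.
apply: wp_seq; apply: wp_mono wI => // -[R' M'] [l]; rewrite addn0 => -> /=.
by move=> [_ R8' -> fr]; apply: wp_skip; exact: wc.
Qed.

End Passes.

(** Register 10 has to receive [2 ^ w] with [w = c * (trunc_log 2 s + 2)]. Register 7 is doubled up
    to the first power of two above [s]; twice that is [2 ^ (trunc_log 2 s + 2)], and [c] such
    factors are multiplied by unrolled code, [c] being a constant of the algorithm. Register 0 is
    cleared to accumulate the answers. *)
Definition setup (c : nat) : cmd :=
  block ([:: Assign 1 (V 0); Assign 0 (Cst 0); Assign 2 (Cst 1);
    While (V 2 * V 2 < V 1 + Cst 1)%X (Assign 2 (V 2 + Cst 1)%X);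
    Assign 3 (Cst 2 * V 2 + Cst 1)%X] ++
  load_digits (V 1) ++
  [:: Assign 4 (V 20); Assign 5 (V 21);
    Assign 6 (Cst 4 * V 1 + Cst 4 * (Cst 2 * (V 3 * V 1) + V 4 + V 5))%X;
    Assign 7 (Cst 2);
    While (V 7 < V 6 + Cst 1)%X (Assign 7 (V 7 + V 7)%X);
    Assign 10 (Cst 1)] ++
  nseq c (Assign 10 (V 10 * (V 7 + V 7))%X) ++
  [:: Assign 11 (V 10 + V 10)%X; Assign 12 (V 10 - Cst 1)%X; Assign 8 (V 10);
    pass emits1; pass emits2; Assign 13 (Cst 0); Assign 14 (Cst 0);
    Assign 32 (V 6)]).

Definition zeros (a m : nat) : seq cmd :=
  [seq Assign d (Cst 0) | d <- iota a m].

Definition prepare_query (m : nat) : cmd :=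
  block (Assign 13 (V 22) :: load_digits ((V 22 + Cst 1) / Cst 2)%X ++
  [:: Assign 23 ((V 22 + Cst 1) / Cst 2)%X;
    Assign 24 (V 22 - Cst 2 * (V 22 / Cst 2))%X] ++
  zeros 32 m ++
  [:: Assign 32 (Cst 2 * (V 1 + V 23))%X;
    Assign 33 (Cst 2 * (V 3 * (V 1 + V 23) + V 4 + V 20 + V 24 - V 2))%X;
    Assign 34 (Cst 2 * (V 3 * (V 1 + V 23) + V 5 + V 21 - V 24 * V 2))%X]).

Definition start_loop : cmd :=
  block [:: Assign 14 (V 11); Assign 22 (V 1 + V 1)%X].

Definition collect_answer : cmd :=
  block [:: Assign 0 (Bin OpOr (V 0) (V 32)); Assign 22 (V 22 - Cst 1)%X].

(** * Word lengths, and the effect and cost of the outer commands *)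

Section Setup.
Variables (c n B : nat) (x : nat -> int).
Hypothesis c_gt0 : (0 < c)%N.
Hypothesis n_gt0 : (0 < n)%N.
Hypothesis x_small : small_instance n x.
Hypothesis nB : (n < B * B)%N.
Hypothesis B_min : (B.-1 * B.-1 <= n)%N.
Local Notation d1 := (digit1 n B x).
Local Notation d0 := (digit0 n B x).
Local Notation s := (size (text n B x)).
Local Notation w := (word_bits c s).
Local Notation w' := (word_bits (6 * c + 1) n).

Lemma inner_word_large : (2 * s + 2 <= 2 ^ w)%N.
Proof.
have s0 : (0 < s)%N by have := n_le_size n_gt0 x_small nB B_min; lia.
have [// _ slt] := andP (trunc_log_bounds (isT : 1 < 2)%N s0).
apply: (@leq_trans (2 ^ (trunc_log 2 s).+2)); first by rewrite expnS; lia.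
by rewrite leq_exp2l// /word_bits -addn2 leq_pmull.
Qed.

(** As [s < 128 * n ^ 2], the inner factor [trunc_log 2 s + 2] is at most [6 * (trunc_log 2 n + 2)].
    The summand 1 in [6 * c + 1] pays for the two additional bits. *)
Lemma outer_word_large : (w.+2 <= w')%N.
Proof.
have s0 : (0 < s)%N by have := n_le_size n_gt0 x_small nB B_min; lia.
have Bn : (B <= n.+1)%N by case: (B) B_min => //= b; nia.
have sn : (s < 128 * (n * n))%N.
  rewrite size_text// /gap.
  have := digit1_lt x_small nB n; have := digit0_lt x nB n; nia.
have /andP[sl _] := trunc_log_bounds (isT : 1 < 2)%N s0.
have /andP[_ nl] := trunc_log_bounds (isT : 1 < 2)%N n_gt0.
have : (2 ^ trunc_log 2 s < 2 ^ (7 + ((trunc_log 2 n).+1 + (trunc_log 2 n).+1)))%N.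
  apply: leq_ltn_trans sl _; apply: leq_trans sn _.
  by rewrite !(expnD 2) leq_mul// leq_mul// ltnW.
rewrite ltn_exp2l// /word_bits => h.
move: (trunc_log 2 s) (trunc_log 2 n) h => a b h.
rewrite mulnDl mul1n -mulnA.
have : (c * (a + 2) <= c * (6 * (b + 2)))%N by rewrite leq_mul2l; lia.
by rewrite mulnCA; lia.
Qed.

Lemma outer_words : (4 * 2 ^ w <= 2 ^ w')%N.
Proof. by rewrite -(expnD 2 2) leq_exp2l// add2n outer_word_large. Qed.

Lemma outer_word_size : (4 * s + 4 <= 2 ^ w')%N.
Proof. by have := outer_words; have := inner_word_large; lia. Qed.

Definition init_memory : nat -> nat := memory (conv3sum_init w' n x).

Lemma init_memoryE i : (0 < i <= n)%N -> init_memory i = input_cell x w' i.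
Proof. by rewrite /init_memory /= => ->. Qed.

Definition globals (R : nat -> nat) : Prop :=
  [/\ [/\ R 1 = n, R 2 = B & R 3 = gap B], R 4 = d1 n, R 5 = d0 n &
      [/\ R 10 = 2 ^ w, R 11 = 2 * 2 ^ w & R 12 = 2 ^ w - 1]]%N.

Lemma wp_powers k a b R M cs T Q : R 7%N = b -> R 10%N = a ->
  (a * (b + b) ^ k < 2 ^ w')%N -> (b + b < 2 ^ w')%N -> (0 < b)%N ->
  (forall R', (forall r, r != 10%N -> R' r = R r) ->
     R' 10%N = (a * (b + b) ^ k)%N -> wp w' (block cs) T Q (R', M)) ->
  wp w' (block (nseq k (Assign 10 (V 10 * (V 7 + V 7))%X) ++ cs))
    (6 * k + T) Q (R, M).
Proof.
elim: k a R => [|k IHk] a R R7 R10 ab bw b0 wc /=.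
  by rewrite muln0 add0n; apply: wc => //; rewrite R10 muln1.
have aE : (a * (b + b) * (b + b) ^ k = a * (b + b) ^ k.+1)%N.
  by rewrite expnS mulnA.
rewrite mulnS -addnA; apply: (@wp_assign_seq _ 10 _ (a * (b + b))%N).
  ev => //; apply: leq_ltn_trans ab; rewrite -aE leq_pmulr// expn_gt0.
  by rewrite addn_gt0 b0.
apply: (IHk (a * (b + b))%N) => //; first by rewrite aE.
move=> R' fr R'10; apply: wc; last by rewrite R'10 aE.
by move=> r r10; rewrite fr// upd_other.
Qed.

Lemma wp_setup : wp w' (setup c) (400 * s + 6 * c + 400)
  (fun st => [/\ globals st.1, st.1 0%N = 0%N,
     [/\ st.1 13 = 0, st.1 14 = 0 & st.1 32 = s]%N
   & st.2 = write_seq init_memory (2 ^ w) [seq nat_of_ord a | a <- text n B x]])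
  (upd (fun=> 0%N) 0 n, init_memory).
Proof.
have wl := outer_word_size; have wl2 := inner_word_large; have wl4 := outer_words.
have ns := n_le_size n_gt0 x_small nB B_min; have gs := gap_le_size n_gt0 x_small nB B_min.
have gns := gapM_le_size n_gt0 x_small nB B_min; have Bg := B_lt_gap B.
have BBs := BB_le_size n_gt0 x_small nB B_min; have B0 := B_gt0 nB.
have s0 : (0 < s)%N by lia.
have /andP[tl1 tl2] := trunc_log_bounds (isT : 1 < 2)%N s0.
have tls : (trunc_log 2 s < s)%N by apply: leq_trans tl1; rewrite ltn_expl.
have sE := size_text x_small nB.
have d1n := digit1_lt x_small nB n; have d0n := digit0_lt x nB n.
pose T2 := (n * (126 * gap B + 500) + 50)%N.
have T2s : (T2 <= 150 * s + 50)%N.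
  by rewrite /T2 mulnDr mulnCA (mulnC n (gap B)); lia.
apply: (@wp_le _ _ (2 + (2 + (2 + (((B.-1 * (4 + 7 + 2) + 7 + 1)) + (6 +
  (1 + 20 + (2 + (2 + (16 + (2 + ((trunc_log 2 s * (4 + 5 + 2) + 5 + 1) + (2 +
  (6 * c + (4 + (4 + (2 + (T2 + (T2 + (2 + (2 + (2 + 0)))))))))))))))))))))).
  by lia.
rewrite /setup.
apply: (@wp_assign_seq _ 1 _ n) => //.
apply: (@wp_assign_seq _ 0 _ 0%N); first by ev; lia.
apply: (@wp_assign_seq _ 2 _ 1%N); first by ev; lia.
set R1 := upd _ 2 1.
apply: (wp_seq (T1 := (B.-1 * (4 + 7 + 2) + 7 + 1)%N)).
pose I1 k (st : state) := (k < B)%N /\ st = (upd R1 2 (B - k)%N, init_memory).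
have loop1 : I1 B.-1 (R1, init_memory).
  split; first by lia.
  congr pair; rewrite (_ : (B - B.-1 = R1 2)%N) ?upd_id//.
  by rewrite /R1 /upd /=; lia.
apply: wp_mono (wp_while _ _ loop1); first exact: leqnn; first last.
- move=> _ [_ ->].
  have -> : eval w' (upd R1 2 (B - 0), init_memory) (V 2 * V 2 < V 1 + Cst 1)%X =
      ((B - 0) * (B - 0) < n + 1)%N by ev; lia.
  by rewrite subn0 addn1 ltnS leqNgt nB.
- move=> k _ [kB ->].
  have le1 : ((B - k.+1) * (B - k.+1) <= B.-1 * B.-1)%N.
    by apply: leq_mul; lia.
  split.
    have -> : eval w' (upd R1 2 (B - k.+1), init_memory)
        (V 2 * V 2 < V 1 + Cst 1)%X =
        ((B - k.+1) * (B - k.+1) < n + 1)%N by ev; lia.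
    by rewrite addn1 ltnS (leq_trans le1).
  apply: (wp_assign (e := (V 2 + Cst 1)%X)); split; first by lia.
  rewrite (_ : eval _ _ _ = (B - k.+1) + 1)%N; last by ev; lia.
  by rewrite /= upd_upd; congr (upd _ _ _, _); lia.
move=> _ [_ ->]; rewrite subn0 {loop1 I1}/R1.
apply: (@wp_assign_seq _ 3 _ (gap B)); first by rewrite /gap; ev; lia.
apply: (@wp_load_digits n B x n_gt0 x_small nB B_min w' wl (V 1) n) => //.
- by lia.
- by rewrite init_memoryE//; lia.
apply: (@wp_assign_seq _ 4 _ (d1 n)); first by ev.
apply: (@wp_assign_seq _ 5 _ (d0 n)); first by ev.
apply: (@wp_assign_seq _ 6 _ s).
  rewrite sE; have -> : (2 * gap B * n = 2 * (gap B * n))%N by rewrite mulnA.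
  by ev; lia.
apply: (@wp_assign_seq _ 7 _ 2%N); first by ev; lia.
set R2 := upd _ 7 2.
apply: (wp_seq (T1 := (trunc_log 2 s * (4 + 5 + 2) + 5 + 1)%N)).
pose I2 k (st : state) := (k <= trunc_log 2 s)%N /\
  st = (upd R2 7 (2 ^ ((trunc_log 2 s).+1 - k))%N, init_memory).
have loop2 : I2 (trunc_log 2 s) (R2, init_memory).
  split => //; congr pair.
  by rewrite subSn// subnn -[(2 ^ 1)%N]/(R2 7%N) upd_id.
have pw k : (2 ^ ((trunc_log 2 s).+1 - k) <= 2 * s)%N.
  apply: (@leq_trans (2 ^ (trunc_log 2 s).+1)); first by rewrite leq_exp2l// leq_subr.
  by rewrite expnS leq_mul2l.
apply: wp_mono (wp_while _ _ loop2); first exact: leqnn; first last.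
- move=> _ [_ ->].
  have := pw 0%N; set P := (2 ^ _)%N => Ps.
  have -> : eval w' (upd R2 7 P, init_memory) (V 7 < V 6 + Cst 1)%X =
      (P < s + 1)%N by ev; lia.
  by rewrite /P subn0 addn1 ltnS leqNgt tl2.
- move=> k _ [kt ->]; have := pw k.+1.
  have PE : (2 ^ ((trunc_log 2 s).+1 - k) = 2 ^ ((trunc_log 2 s).+1 - k.+1) +
      2 ^ ((trunc_log 2 s).+1 - k.+1))%N.
    by rewrite addnn -mul2n -expnS; congr (2 ^ _)%N; lia.
  have le1 : (2 ^ ((trunc_log 2 s).+1 - k.+1) <= s)%N.
    by apply: leq_trans tl1; rewrite leq_exp2l// subSS leq_subr.
  move: PE le1; set P := (2 ^ (_ - k.+1))%N => PE le1 Ps; split.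
    have -> : eval w' (upd R2 7 P, init_memory) (V 7 < V 6 + Cst 1)%X =
        (P < s + 1)%N by ev; lia.
    by rewrite addn1 ltnS le1.
  apply: (wp_assign (e := (V 7 + V 7)%X)); split; first by lia.
  rewrite (_ : eval _ _ _ = P + P)%N; last by ev; lia.
  by rewrite /= upd_upd PE.
move=> _ [_ ->]; rewrite subn0 {loop2 I2}/R2; have := pw 0%N; rewrite subn0.
set t := (2 ^ (trunc_log 2 s).+1)%N => ts.
apply: (@wp_assign_seq _ 10 _ 1%N); first by ev; lia.
have tW : ((t + t) ^ c = 2 ^ w)%N.
  by rewrite addnn -mul2n -expnS -expnM mulnC /word_bits addn2.
apply: (@wp_powers c 1 t) => //.
- by rewrite mul1n tW; lia.
- by lia.
- by rewrite expn_gt0.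
move=> R3 fr; rewrite mul1n tW => R3W.
have R3n : R3 1%N = n by rewrite fr.
have R3B : R3 2%N = B by rewrite fr.
have R3g : R3 3%N = gap B by rewrite fr.
have R31 : R3 4%N = d1 n by rewrite fr.
have R30 : R3 5%N = d0 n by rewrite fr.
have R3s : R3 6%N = s by rewrite fr.
have R3z : R3 0%N = 0%N by rewrite fr.
rewrite {tW}; set W := (2 ^ w)%N in wl2 wl4 R3W *.
apply: (@wp_assign_seq _ 11 _ (W + W)%N); first by ev; lia.
apply: (@wp_assign_seq _ 12 _ (W - 1)%N); first by ev; lia.
apply: (@wp_assign_seq _ 8 _ W); first by ev.
have sT : (size (half1 (gap1 n B x) (gap0 n B x) n) +
    size (half2 (gap1 n B x) (gap0 n B x) n) = s)%N by rewrite -size_cat.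
apply: (@wp_pass n B x n_gt0 x_small nB B_min w' wl emits1 block1 W).
- exact (emits1P n_gt0 nB B_min wl).
- by move=> p q p0 q0; rewrite /block1 /= !size_cat !size_nseq /=; lia.
- by move=> i ib; rewrite init_memoryE.
- by [].
- by [].
- by [].
- by [].
- by lia.
- by move: sT; rewrite /half1; lia.
move=> R4 fr4 R48.
apply: (@wp_pass n B x n_gt0 x_small nB B_min w' wl emits2 block2
  (W + size (half1 (gap1 n B x) (gap0 n B x) n))).
- exact (emits2P n_gt0 nB B_min wl).
- by move=> p q p0 q0; rewrite /block2 /= !size_cat !size_nseq /=; lia.
- by move=> i ib; rewrite write_seq_lt ?init_memoryE//; lia.
- by rewrite fr4.
- by rewrite fr4.
- by rewrite fr4.
- by [].
- by lia.
- by move: sT; rewrite /half2; lia.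
move=> R5 fr5 R58.
have frE r : ~~ scratch r -> r != 11%N -> r != 12%N -> R5 r = R3 r.
  move=> sr r11 r12; rewrite fr5// fr4// !upd_other//.
  by move: sr; rewrite /scratch; case: (r == 8%N).
have R5s : R5 6%N = s by rewrite frE.
apply: (@wp_assign_seq _ 13 _ 0%N); first by ev; lia.
apply: (@wp_assign_seq _ 14 _ 0%N); first by ev; lia.
apply: (@wp_assign_seq _ 32 _ s); first by ev.
apply: wp_skip; split => /=.
- split; [split| | |split]; rewrite /upd /=.
  1-6: by rewrite frE.
  + by rewrite fr5// fr4//= /upd /= addnn mul2n.
  + by rewrite fr5// fr4.
- by rewrite /upd /= frE.
- by [].
- by rewrite /text map_cat -write_seq_cat size_map.
Qed.

Definition zero_regs (R : nat -> nat) (a m : nat) : nat -> nat :=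
  fun r => if (a <= r < a + m)%N then 0%N else R r.

Lemma wp_zeros a m R M cs T Q :
  wp w' (block cs) T Q (zero_regs R a m, M) ->
  wp w' (block (zeros a m ++ cs)) (2 * m + T) Q (R, M).
Proof.
elim: m a R => [|m IHm] a R wc /=.
  rewrite muln0; move: wc; rewrite (_ : zero_regs R a 0 = R)//.
  by apply/funext => r; rewrite /zero_regs addn0; case: ifP => //; lia.
rewrite mulnS -addnA; apply: (@wp_assign_seq _ _ _ 0%N).
  by ev; rewrite expn_gt0.
apply: IHm; rewrite (_ : zero_regs _ _ _ = zero_regs R a m.+1)//.
apply/funext => r; rewrite /zero_regs /upd.
case: (boolP (a < r < a.+1 + m)%N) => h1; first by rewrite ifT//; lia.
by case: (r =P a) => h2; [rewrite ifT//; lia|rewrite ifF//; lia].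
Qed.

Lemma wp_prepare_query m j R M : globals R -> R 14%N = (2 * 2 ^ w)%N ->
  R 22%N = j -> (0 < j <= 2 * n)%N -> (2 < m)%N ->
  (forall i, (0 < i <= n)%N -> M i = input_cell x w' i) ->
  wp w' (prepare_query m) (2 * m + 200) (fun st =>
    [/\ globals st.1, [/\ st.1 0 = R 0, st.1 14 = 2 * 2 ^ w, st.1 13 = j
                        & st.1 22 = j]%N,
        forall d, (d < m)%N -> st.1 (32 + d)%N =
          (if insub d is Some a then query_vec n B x j a else 0%N) & st.2 = M])
    (R, M).
Proof.
have wl := outer_word_size; have wl2 := inner_word_large; have wl4 := outer_words.
have ns := n_le_size n_gt0 x_small nB B_min; have gs := gap_le_size n_gt0 x_small nB B_min.
have gns := gapM_le_size n_gt0 x_small nB B_min; have Bg := B_lt_gap B.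
have BBs := BB_le_size n_gt0 x_small nB B_min; have B0 := B_gt0 nB.
move=> [[R1 R2 R3] R4 R5 [R10 R11 R12]] R14 R22 jb m2 Mi.
pose k := (j.+1 %/ 2)%N; pose cy := (j %% 2)%N.
have kb : (0 < k <= n)%N by rewrite /k; lia.
have kE : ((j + 1) %/ 2 = k)%N by rewrite addn1.
have oE : (j - 2 * (j %/ 2) = cy)%N by rewrite /cy; lia.
have o2 : (cy < 2)%N by rewrite ltn_mod.
have oB : (cy * B <= B)%N by case: (cy) o2 => [|[|?]] //; lia.
have gE : (gap B * (n + k) = gap B * n + gap B * k)%N by rewrite mulnDr.
have gk : (gap B * k <= gap B * n)%N by rewrite leq_mul2l; lia.
have gk' : (gap B <= gap B * k)%N by rewrite leq_pmulr//; lia.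
have d1n := digit1_lt x_small nB n; have d0n := digit0_lt x nB n.
have d1k := digit1_lt x_small nB k; have d0k := digit0_lt x nB k.
apply: (@wp_le _ _ (2 + (5 + 20 + (6 + (8 + (2 * m + (6 + (16 + (16 + 0)))))))));
  first by lia.
rewrite /prepare_query.
apply: (@wp_assign_seq _ 13 _ j); first by ev.
apply: (@wp_load_digits n B x n_gt0 x_small nB B_min w' wl ((V 22 + Cst 1) / Cst 2)%X k) => //.
- by rewrite -kE; ev; lia.
- exact: Mi.
apply: (@wp_assign_seq _ 23 _ k); first by rewrite -kE; ev; lia.
apply: (@wp_assign_seq _ 24 _ cy); first by rewrite -oE; ev; lia.
apply: wp_zeros.
set R' := zero_regs _ _ _.
have R'E r : (r < 32)%N -> r != 13%N -> ~~ (20 <= r <= 25)%N -> R' r = R r.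
  move=> r32 r13 r20; rewrite /R' /zero_regs ifF; last by lia.
  by rewrite !upd_other//; lia.
have R'0 r : (32 <= r < 32 + m)%N -> R' r = 0%N.
  by move=> rm; rewrite /R' /zero_regs rm.
have R'1 : R' 1%N = n by rewrite R'E.
have R'2 : R' 2%N = B by rewrite R'E.
have R'3 : R' 3%N = gap B by rewrite R'E.
have R'4 : R' 4%N = d1 n by rewrite R'E.
have R'5 : R' 5%N = d0 n by rewrite R'E.
have R'13 : R' 13%N = j by rewrite /R' /zero_regs /upd.
have R'20 : R' 20%N = d1 k by rewrite /R' /zero_regs /upd.
have R'21 : R' 21%N = d0 k by rewrite /R' /zero_regs /upd.
have R'23 : R' 23%N = k by rewrite /R' /zero_regs /upd.
have R'24 : R' 24%N = cy by rewrite /R' /zero_regs /upd.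
apply: (@wp_assign_seq _ 32 _ (2 * (n + k))%N); first by ev; lia.
apply: (@wp_assign_seq _ 33 _
  (2 * (gap B * (n + k) + d1 n + d1 k + cy - B))%N); first by ev; lia.
apply: (@wp_assign_seq _ 34 _
  (2 * (gap B * (n + k) + d0 n + d0 k - cy * B))%N); first by ev; lia.
apply: wp_skip; split => // d dm; case: insubP => [a _ <-|d3]; last first.
  by rewrite /= !upd_other ?R'0//; lia.
by rewrite /query_vec ffunE -/k -/cy; elim/ord3P: a.
Qed.

End Setup.

Definition reg_bound (i : instr) : nat :=
  match i with
  | Const d _ => d.+1
  | Op _ d a b => (d + a + b).+1
  | Read d a => (d + a).+1
  | Write a b => (a + b).+1
  | Rand d => d.+1
  | Jump _ => 0
  | JumpIfZero a _ => a.+1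
  end%N.

Definition num_regs (p : program) : nat :=
  foldr (fun i k => maxn (reg_bound i) k) 0%N p.

Lemma num_regsP p m : (num_regs p <= m)%N -> all (regs_below m) p.
Proof.
elim: p => //= i p IHp; rewrite geq_max => /andP[im /IHp ->]; rewrite andbT.
by case: i im => //= *; lia.
Qed.

Lemma cmd_below_block tb cs : cmd_below tb (block cs) = all (cmd_below tb) cs.
Proof. by elim: cs => //= c cs ->. Qed.

Lemma expr_below_le tb tb' e : (tb <= tb')%N -> expr_below tb e ->
  expr_below tb' e.
Proof.
move=> tt; elim: e => //= [r|op e1 IH1 e2 IH2]; first by move=> h; lia.
by move=> /andP[/IH1 -> /IH2 ->].
Qed.

Lemma cmd_below_le tb tb' c : (tb <= tb')%N -> cmd_below tb c ->
  cmd_below tb' c.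
Proof.
move=> tt; have el := expr_below_le tt.
elim: c => //= [d e|e1 e2|c1 IH1 c2 IH2|e c IHc] /andP[].
- by move=> dt /el ->; rewrite andbT; lia.
- by move=> /el -> /el ->.
- by move=> /IH1 -> /IH2 ->.
- by move=> /el -> /IHc ->.
Qed.

Lemma setup_below c : cmd_below 33 (setup c).
Proof.
by rewrite /setup cmd_below_block !all_cat all_nseq /= orbT.
Qed.

Lemma prepare_query_below m : (2 < m)%N -> cmd_below (32 + m) (prepare_query m).
Proof.
move=> m2; rewrite /prepare_query cmd_below_block /= all_cat.
rewrite (_ : all _ (zeros 32 m)) /=; first by do !(apply/andP; split); lia.
by rewrite /zeros all_map; apply/allP => d; rewrite mem_iota /=; lia.
Qed.

(** * The assembled program and its runs *)

Section Program.
Variable A : indexing_algorithm.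
Local Notation pre := (idx_preprocess A).
Local Notation qry := (idx_query A).
Local Notation c := (idx_word A).

(** At least three registers are simulated, because the entries of a query vector arrive in the
    first three. *)
Definition sim_regs_num : nat := (3 + maxn (num_regs pre) (num_regs qry))%N.
Local Notation m := sim_regs_num.
Local Notation tb := (32 + m)%N.

Definition off_pre : nat := (1 + cmd_size (setup c))%N.
Definition off_start : nat := (off_pre + 8 * size pre)%N.
Definition off_loop : nat := (off_start + cmd_size start_loop)%N.
Definition off_query : nat := (off_loop + 1 + cmd_size (prepare_query m))%N.
Definition off_collect : nat := (off_query + 8 * size qry)%N.
Definition off_end : nat := (off_collect + cmd_size collect_answer + 1)%N.

(** For [n = 0] the first instruction jumps to the end: register 0 then already holds the negative
    answer, and the rest of the program may rely on [n] being positive. *)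
Definition reduction_prog : program :=
  [:: JumpIfZero 0 off_end] ++ compile tb 1 (setup c) ++
  sim_code tb off_pre pre ++ compile tb off_start start_loop ++
  [:: JumpIfZero 22 off_end] ++ compile tb (off_loop + 1) (prepare_query m) ++
  sim_code tb off_query qry ++ compile tb off_collect collect_answer ++
  [:: Jump off_loop].
Local Notation P := reduction_prog.

Lemma size_reduction_prog : size P = off_end.
Proof.
rewrite /P; move: (size_compile tb 1 (setup c)) (size_sim_code tb off_pre pre).
move: (size_compile tb off_start start_loop) (size_sim_code tb off_query qry).
move: (size_compile tb (off_loop + 1) (prepare_query m)).
move: (size_compile tb off_collect collect_answer).
move: (compile tb 1 _) (sim_code tb off_pre _) (compile tb off_start _).
move: (compile tb (off_loop + 1) _) (sim_code tb off_query _).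
move: (compile tb off_collect _) => l1 l2 l3 l4 l5 l6 e1 e2 e3 e4 e5 e6.
rewrite !size_cat e1 e2 e3 e4 e5 e6 /off_end /off_collect.
rewrite /off_query /off_loop /off_start /off_pre -![size [:: _]]/1%N.
move: (cmd_size (setup c)) (cmd_size start_loop) (cmd_size collect_answer).
by move: (cmd_size (prepare_query m)); lia.
Qed.

Lemma reduction_code :
  [/\ [/\ nth (Jump 0) P 0 = JumpIfZero 0 off_end,
          code_at P 1 (compile tb 1 (setup c)),
          code_at P off_pre (sim_code tb off_pre pre) &
          code_at P off_start (compile tb off_start start_loop)],
      [/\ nth (Jump 0) P off_loop = JumpIfZero 22 off_end,
          code_at P (off_loop + 1) (compile tb (off_loop + 1) (prepare_query m))
        & code_at P off_query (sim_code tb off_query qry)],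
      code_at P off_collect (compile tb off_collect collect_answer) &
      nth (Jump 0) P off_end.-1 = Jump off_loop].
Proof.
have : code_at P 0 P by split => // j; rewrite add0n.
rewrite {2}/P => /code_at_cat[c0] /code_at_cat[c1] /code_at_cat[c2].
move=> /code_at_cat[c3] /code_at_cat[c4] /code_at_cat[c5] /code_at_cat[c6].
move=> /code_at_cat[c7 c8].
rewrite !(size_compile, size_sim_code) add0n in c1 c2 c3 c4 c5 c6 c7 c8.
rewrite -[(size [:: _] + cmd_size _)%N]/off_pre in c2 c3 c4 c5 c6 c7 c8.
rewrite -/off_start -/off_loop in c3 c4 c5 c6 c7 c8.
rewrite -/off_query -/off_collect in c6 c7 c8.
split; [split => // | split => // | by [] | ].
- by rewrite -[X in nth _ _ X]addn0 (code_at_nth _ c4).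
- have -> : off_end.-1 = (off_collect + cmd_size collect_answer + 0)%N.
    by rewrite /off_end addn0 addn1.
  by rewrite (code_at_nth _ c8).
Qed.

Lemma off_loop_lt : (off_loop < off_end)%N.
Proof.
rewrite /off_end /off_collect /off_query; move: (prepare_query m) => pq; lia.
Qed.

Lemma run_cmd w off cd R M T Q : wp w cd T Q (R, M) -> cmd_below tb cd ->
  code_at P off (compile tb off cd) ->
  exists t R' M', [/\ (t <= T)%N, det_run w P t (Config off R M)
     (Config (off + cmd_size cd) R' M') &
     exists2 R1, Q (R1, M') /\ (forall r, (r < tb)%N -> R' r = R1 r) &
       forall tb', cmd_below tb' cd -> forall r, (tb' <= r)%N -> R1 r = R r].
Proof.
move=> [t [[R1 M1] [ex tT q]]] cb cat.
have [R' ag run] := compileP ex cb cat (fun r _ => erefl).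
exists t, R', M1; split => //; exists R1 => //.
by move=> tb' cb' r tr; exact: (exec_below ex cb' tr).
Qed.

Section Instance.
Variables (n B : nat) (x : nat -> int).
Hypothesis n_gt0 : (0 < n)%N.
Hypothesis x_small : small_instance n x.
Hypothesis nB : (n < B * B)%N.
Hypothesis B_min : (B.-1 * B.-1 <= n)%N.
Local Notation S := (text n B x).
Local Notation s := (size S).
Local Notation w := (idx_bits A s).
Local Notation w' := (word_bits (6 * c + 1) n).
Local Notation W := (2 ^ w)%N.
Local Notation qv := (query_vec n B x).
Let c_gt0 : (0 < c)%N := idx_word_gt0 A.
Let wl2 : (2 * s + 2 <= W)%N := inner_word_large c_gt0 n_gt0 x_small nB B_min.
Let ww' : (w.+2 <= w')%N := outer_word_large c_gt0 n_gt0 x_small nB B_min.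
Let wl4 : (4 * W <= 2 ^ w')%N := outer_words c_gt0 n_gt0 x_small nB B_min.
Let w_gt0 : (0 < w)%N.
Proof. by rewrite /idx_bits /word_bits muln_gt0 c_gt0 addn_gt0 orbT. Qed.
Let m3 : (2 < m)%N.
Proof. by rewrite /sim_regs_num; lia. Qed.
Let nW : (n < W)%N.
Proof. by have := n_le_size n_gt0 x_small nB B_min; lia. Qed.

Lemma word_vector_query j : (0 < j <= 2 * n)%N -> word_vector w (qv j).
Proof. by move=> jb a; have := query_vec_le x_small nB a jb; lia. Qed.

(* The outer configuration [C] at the head of the query loop: [ci] is the
   index, [j] queries remain, [acc] is nonzero if one has succeeded. *)
Definition loop_inv (j acc : nat) (ci C : config) : Prop :=
  [/\ pc C = off_loop, globals c n B x (regs C),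
      [/\ regs C 14 = 2 * W, regs C 22 = j & regs C 0 = acc]%N,
      forall i, (i < W)%N -> memory C i = init_memory c n x i
    & [/\ forall a, (a < W)%N -> memory ci a = memory C (a + W)%N,
          forall a, (a < W)%N -> (memory ci a < W)%N
        & forall a, (a < W)%N ->
            memory C (a + 2 * W)%N = 0%N \/ (j < memory C (a + 2 * W))%N]].

Lemma setup_run : exists t C1,
  [/\ (t <= 400 * s + 6 * c + 401)%N,
      det_run w' P t (conv3sum_init w' n x) C1,
      globals c n B x (regs C1),
      regs C1 0%N = 0%N & [/\ regs C1 13 = 0, regs C1 14 = 0 &
      (forall i, i < W -> memory C1 i = init_memory c n x i) /\
      (forall i, 2 * W <= i -> memory C1 i = 0)]%N /\
      sim w m off_pre pre (regs C1) (memory C1) 0 0 (preprocess_init S) C1].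
Proof.
have [[c0 c1 _ _] _ _ _] := reduction_code.
have wps := wp_setup c_gt0 n_gt0 x_small nB B_min.
have cb : cmd_below tb (setup c) by apply: cmd_below_le (setup_below c); lia.
have [t [R' [M' [tT run [R1 [[/= gl R10 [R113 R114 R132] M'E] ag] fr]]]]] :=
  run_cmd wps cb c1.
have {}M'E : M' = write_seq (init_memory c n x) W [seq nat_of_ord a | a <- S] := M'E.
have {}fr r : (33 <= r)%N -> R1 r = 0%N.
  by move=> r33; rewrite (fr _ (setup_below c) _ r33) upd_other//; lia.
have sm : size [seq nat_of_ord a | a <- S] = s by rewrite size_map.
exists (1 + t)%N, (Config off_pre R' M'); split.
- by lia.
- apply: det_run_trans run.
  have := @det_run_jump_if_zero w' P 0 0 off_end (upd (fun=> 0%N) 0 n)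
    (init_memory c n x).
  rewrite upd_same (gtn_eqF n_gt0); apply; last exact: c0.
  by rewrite size_reduction_prog; have := off_loop_lt; lia.
- by move: gl; rewrite /globals /=; rewrite !ag//; lia.
- by rewrite /= ag//; lia.
split; first split => /=.
- by rewrite ag//; lia.
- by rewrite ag//; lia.
- split=> i iW; first by rewrite M'E write_seq_lt.
  rewrite M'E /write_seq sm ifF; last by lia.
  by rewrite /init_memory /= ifF//; lia.
split => /=.
- by rewrite /sim_label min0n muln0 addn0.
- split => // d dm.
  + rewrite ag; last by lia.
    by rewrite /upd; case: d dm => [|d] dm; [rewrite addn0 R132|rewrite fr//; lia].
  + by rewrite /upd; case: eqP => _; [lia|rewrite expn_gt0].
- split => // [a aW|a aW|a aW].
  + rewrite muln0 addn0 M'E /write_seq sm leq_addl /= addnC ltn_add2l addKn.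
    case: ltnP => // sa; rewrite nth_default ?sm// /init_memory /= ifF//.
    by lia.
  + have [sa|sa] := ltnP a s; last by rewrite nth_default ?sm// expn_gt0.
    rewrite (nth_map lh)//; apply: leq_trans (ltn_ord _) _.
    by have := n_le_size n_gt0 x_small nB B_min; lia.
  + by left.
Qed.

Lemma start_loop_run R0 M0 ci C : globals c n B x R0 -> R0 0%N = 0%N ->
  (forall i, i < W -> M0 i = init_memory c n x i)%N ->
  (forall i, 2 * W <= i -> M0 i = 0)%N ->
  sim w m off_pre pre R0 M0 0 0 ci C -> halted pre ci ->
  exists t C', [/\ (t <= 10)%N, det_run w' P t C C' & loop_inv (2 * n) 0 ci C'].
Proof.
move=> gl R00 M0W M02 si hc.
have pcC : pc C = off_start.
  by have := sim_halted si hc; rewrite size_sim_code.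
have [[_ _ _ c3] _ _ _] := reduction_code.
case: C si pcC => pcC RC MC [_ [_ _ sR3] [sM1 sM2 sM3 sM4]] /= pcE.
rewrite /= in sR3 sM1 sM2 sM3 sM4.
have [[g1 g2 g3] g4 g5 [g10 g11 g12]] := gl.
have nns := n_le_size n_gt0 x_small nB B_min.
have R1 : RC 1%N = n by rewrite sR3.
have R11 : RC 11%N = (2 * W)%N by rewrite sR3.
have wps : wp w' start_loop (2 + (4 + 0)) (fun st => st =
    (upd (upd RC 14 (2 * W)) 22 (n + n)%N, MC)) (RC, MC).
  apply: (@wp_assign_seq _ 14 _ (2 * W)%N); first by ev.
  apply: (@wp_assign_seq _ 22 _ (n + n)%N); first by ev; lia.
  exact: wp_skip.
have cb : cmd_below tb start_loop by apply: (@cmd_below_le 32) => //; lia.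
have [t [R' [M' [tT run [R2 [[R2E M'E] ag] fr]]]]] := run_cmd wps cb c3.
exists t, (Config off_loop R' M'); split => //.
- by lia.
- by rewrite pcE.
have {}ag r : (r < 32)%N -> R' r = upd (upd RC 14 (2 * W)) 22 (n + n) r.
  by move=> r32; rewrite ag ?R2E//; lia.
split => //=.
- by split; [split| | |split]; rewrite ag// /upd /= sR3.
- by split; rewrite ag// /upd //=; [lia|rewrite sR3].
- by move=> i iW; rewrite M'E sM3 ?iW// M0W.
- rewrite M'E; split => // a aW; first by rewrite sM1// muln0 addn0.
  (* Preprocessing stamps its writes with [q = 0], so every stamp is still 0 when the queries
     begin. *)
  by case: (sM4 _ aW) => ->; [left; rewrite M02//; lia|left].
Qed.

(** Earlier queries have larger numbers, so no cell carries the stamp [j.+1] yet, and the simulated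
    query sees precisely the memory of [ci], whatever the overlay contains. *)
Lemma loop_start_run j acc ci C : loop_inv j.+1 acc ci C -> (j < 2 * n)%N ->
  exists t C1, [/\ (t <= 2 * m + 201)%N, det_run w' P t C C1,
    globals c n B x (regs C1),
    [/\ regs C1 14 = 2 * W, regs C1 13 = j.+1, regs C1 22 = j.+1 &
        regs C1 0 = acc]%N &
    [/\ memory C1 = memory C &
    sim w m off_query qry (regs C1) (memory C1) j.+1 (2 * W)
      (query_init (qv j.+1) ci) C1]].
Proof.
case: C => pcC RC MC [/= -> gl [R14 R22 R0] Mi [Mc Mw Ms]] jn.
have [_ [c4 c5 c6] _ _] := reduction_code.
have jb : (0 < j.+1 <= 2 * n)%N by [].
have Mx i : (0 < i <= n)%N -> MC i = input_cell x w' i.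
  by move=> ib; rewrite Mi ?init_memoryE//; lia.
have wps := wp_prepare_query c_gt0 n_gt0 x_small nB B_min gl R14 R22 jb m3 Mx.
have [t [R' [M' [tT run [R1 [[/= gl1 [R10 R114 R113 R122] R1d M'E] ag] fr]]]]] :=
  run_cmd wps (prepare_query_below m3) c5.
exists (1 + t)%N, (Config off_query R' M'); split => //=.
- by lia.
- apply: det_run_trans run.
  have := @det_run_jump_if_zero w' P off_loop 22 off_end RC MC.
  rewrite R22 (_ : (j.+1 == 0%N) = false)// -[off_loop.+1]addn1.
  by apply => //; rewrite addn1 size_reduction_prog off_loop_lt.
- by move: gl1; rewrite /globals /=; rewrite !ag//; lia.
- by rewrite !ag ?R10//; lia.
split => //; split => /=.
- by rewrite /sim_label min0n muln0 addn0.
- split => // d dm; first by rewrite ag ?R1d//; lia.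
  case: insubP => [a _ _|_]; last by rewrite expn_gt0.
  exact: word_vector_query.
- rewrite M'E; split => // a aW; last by left.
  rewrite Mc//; case: eqP => [e|_]; last by rewrite mul0n addn0.
  by case: (Ms _ aW); rewrite e => //; lia.
Qed.

(** The query wrote to the overlay only, so the index is intact; its stamps [j.+1] exceed [j], which
    restores the invariant for the next query. *)
Lemma loop_end_run j acc ci R0 M0 c' C : globals c n B x R0 ->
  [/\ R0 14 = 2 * W, R0 13 = j.+1, R0 22 = j.+1 & R0 0 = acc]%N ->
  (forall i, (i < W)%N -> M0 i = init_memory c n x i) ->
  (forall a, (a < W)%N -> memory ci a = M0 (a + W)%N) ->
  (forall a, (a < W)%N -> (memory ci a < W)%N) ->
  (forall a, (a < W)%N -> M0 (a + 2 * W)%N = 0%N \/ (j.+1 < M0 (a + 2 * W))%N) ->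
  (j < 2 * n)%N ->
  sim w m off_query qry R0 M0 j.+1 (2 * W) c' C -> halted qry c' ->
  exists t C', [/\ (t <= 20)%N, det_run w' P t C C'
    & loop_inv j (Nat.lor acc (regs c' 0)) ci C'].
Proof.
move=> gl [R14 R13 R22 R00] Mi Mc Mw Ms jn si hc.
have pcC : pc C = off_collect.
  have := sim_halted si hc.
  by rewrite size_sim_code.
have [_ _ c7 c8] := reduction_code.
case: C si pcC => pcC RC MC [_ [sR1 _ sR3] [_ _ sM3 sM4]] /= pcE.
rewrite /= in sR1 sR3 sM3 sM4.
have [[g1 g2 g3] g4 g5 [g10 g11 g12]] := gl.
have nns := n_le_size n_gt0 x_small nB B_min.
have RC22 : RC 22%N = j.+1 by rewrite sR3.
have W0 : (0 < W)%N by rewrite expn_gt0.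
have RC32 : RC 32%N = regs c' 0%N by rewrite -[32%N]addn0 sR1.
have wps : wp w' collect_answer (4 + (4 + 0)) (fun st => st =
    (upd (upd RC 0 (Nat.lor acc (regs c' 0%N))) 22 j, MC)) (RC, MC).
  apply: (@wp_assign_seq _ 0 _ (Nat.lor acc (regs c' 0%N))).
    by rewrite /= RC32 sR3// R00.
  apply: (@wp_assign_seq _ 22 _ j).
    by rewrite [RHS](_ : _ = j.+1 - 1)%N; [ev; lia|rewrite subn1].
  exact: wp_skip.
have cb : cmd_below tb collect_answer by apply: (@cmd_below_le 33) => //; lia.
have [t [R' [M' [tT run [R2 [[R2E M'E] ag] fr]]]]] := run_cmd wps cb c7.
exists (t + 1)%N, (Config off_loop R' M'); split => //.
- by lia.
- apply: det_run_trans; first by rewrite pcE; exact: run.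
  apply: det_run_jump.
    by rewrite size_reduction_prog /off_end addn1.
  by move: c8; rewrite /off_end addn1.
have {}ag r : (r < 32)%N ->
    R' r = upd (upd RC 0 (Nat.lor acc (regs c' 0%N))) 22 j r.
  by move=> r32; rewrite ag ?R2E//; lia.
have sM3' i : (i < 2 * W)%N -> MC i = M0 i.
  by move=> iW; apply: sM3; rewrite iW; lia.
split => //=.
- by split; [split| | |split]; rewrite ag// /upd /= sR3.
- by split; rewrite ag// /upd //= sR3.
- by move=> i iW; rewrite M'E sM3' ?Mi//; lia.
- rewrite M'E; split => // a aW; first by rewrite sM3' ?Mc//; lia.
  case: (sM4 _ aW) => ->; last by right.
  by case: (Ms _ aW) => h; [left|right; lia].
Qed.

Lemma loop_exit_run acc ci C : loop_inv 0 acc ci C ->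
  exists2 C', det_run w' P 1 C C' & halted P C' /\ regs C' 0%N = acc.
Proof.
case: C => pcC RC MC [/= -> _ [_ R22 R0] _ _].
have [_ [c4 _ _] _ _] := reduction_code.
have := @det_run_jump_if_zero w' P off_loop 22 off_end RC MC.
rewrite R22 eqxx => run; exists (Config off_end RC MC).
  by apply: run; rewrite ?size_reduction_prog ?off_loop_lt.
by split; first by rewrite /halted size_reduction_prog.
Qed.

Lemma preprocess_regs : all (regs_below m) pre.
Proof. by apply: num_regsP; rewrite /sim_regs_num; lia. Qed.

Lemma query_regs : all (regs_below m) qry.
Proof. by apply: num_regsP; rewrite /sim_regs_num; lia. Qed.

Section Expectation.
Variable RR : realType.
Hypothesis A_solves : solves_jumbled_indexing RR 3 A.
Local Open Scope ereal_scope.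
Local Notation E := (answers (conv3sum n x)).

(** The hypothesis on the indexing algorithm concerns one query vector at a time, whereas the loop
    asks many of the same random index. The event defined here is what has to hold almost surely. *)
Definition good_index (ci : config) : Prop :=
  forall psi, word_vector w psi ->
    halt_prob RR w qry (answers (jumbled_occurs S psi)) (query_init psi ci) = 1.

Lemma loop_prob j acc ci C : good_index ci -> loop_inv j acc ci C ->
  (j <= 2 * n)%N ->
  (acc != 0%N <-> exists2 k, (j < k <= 2 * n)%N & jumbled_occurs S (qv k)) ->
  1 <= halt_prob RR w' P E C.
Proof.
move=> good; elim: j acc C => [|j IHj] acc C inv jn accE.
  have [C' run [hC' C'0]] := loop_exit_run inv.
  rewrite /halt_prob (det_run_expect _ run)//.
  rewrite halt_expect_halted// indicE mem_set// /answers /= C'0.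
  by rewrite accE (conv3sum_queries x_small nB).
have [t [C1 [_ run gl1 R1 [M1 si]]]] := loop_start_run inv jn.
have [_ _ _ Mi [Mc Mw Ms]] := inv.
have [g14 g13 _ _] := R1; have [_ _ _ [g10 g11 g12]] := gl1.
rewrite /halt_prob (det_run_expect _ run)//.
rewrite -[leLHS](good _ (word_vector_query (jn : (0 < j.+1 <= 2 * n)%N))).
have [_ [_ _ c6] _ _] := reduction_code.
apply: (@sim_halt_expect w w' m off_query qry P w_gt0 ww' query_regs c6
  (regs C1) (memory C1) j.+1 (2 * W)) si => //; first by right.
move=> c' C' si' hc'; rewrite indicE.
have [/set_mem ans|_] := boolP (c' \in _); last first.
  by apply: halt_expect_ge0 => ?; rewrite lee_fin.
rewrite M1 in si'.
have [t' [C'' [_ run' inv']]] := loop_end_run gl1 R1 Mi Mc Mw Ms jn si' hc'.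
rewrite (det_run_expect _ run')//.
apply: (IHj _ _ inv'); first exact: ltnW.
have -> : (Nat.lor acc (regs c' 0) != 0%N) <->
    (acc != 0%N \/ regs c' 0%N != 0%N).
  have := PeanoNat.Nat.lor_eq_0_iff acc (regs c' 0%N) => h; split.
    have [a0|] := eqVneq acc 0%N; last by left.
    by move=> l0; right; apply: contraNneq l0 => r0; apply/eqP/h.
  by case=> e; apply: contraNneq e => /h[e1 e2]; apply/eqP.
have {}ans : regs c' 0%N != 0%N <-> jumbled_occurs S (qv j.+1) := ans.
rewrite accE ans; split => [[[k kb ok]|oj]|[k kb ok]].
- by exists k => //; lia.
- by exists j.+1 => //; lia.
have [kj|kj] := eqVneq k j.+1; first by right; rewrite -kj.
by left; exists k => //; lia.
Qed.

Lemma reduction_correct : halt_prob RR w' P E (conv3sum_init w' n x) = 1.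
Proof.
apply/eqP; rewrite eq_le halt_prob_le1 /=.
have [t [C1 [_ run gl R0 [[R13 R14 [Mi M2]] si]]]] := setup_run.
have [g1 _ _ [g10 g11 g12]] := gl.
rewrite /halt_prob (det_run_expect _ run)//.
(* [halt_prob_all] merges the almost sure correctness of each word vector into one almost sure
   event. *)
have good1 : 1 <= halt_prob RR w pre good_index (preprocess_init S).
  pose I := {psi : {ffun 'I_3 -> nat} | word_vector w psi}.
  pose G (i : I) ci :=
    halt_prob RR w qry (answers (jumbled_occurs S (sval i)))
      (query_init (sval i) ci).
  have z : word_vector w ([ffun=> 0%N] : {ffun 'I_3 -> nat}).
    by move=> a; rewrite ffunE expn_gt0.
  have := @halt_prob_all RR w pre I G (preprocess_init S) (exist _ _ z).
  rewrite (_ : [set _ | _] = good_index); last first.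
    apply/funext => ci; apply/propext; split => [h psi wp|h i].
      exact: (h (exist _ _ wp)).
    exact: h (svalP i).
  apply; first by move=> i ci; rewrite halt_prob_ge0 halt_prob_le1.
  by move=> [psi wp]; exact: A_solves.
apply: (le_trans good1).
have [[_ _ c2 _] _ _ _] := reduction_code.
apply: (@sim_halt_expect w w' m off_pre pre P w_gt0 ww' preprocess_regs c2
  (regs C1) (memory C1) 0 0) si => //; first by left.
move=> ci C' si' hc'; rewrite indicE.
have [/set_mem good|_] := boolP (ci \in _); last first.
  by apply: halt_expect_ge0 => ?; rewrite lee_fin.
have [t' [C'' [_ run' inv']]] := start_loop_run gl R0 Mi M2 si' hc'.
rewrite (det_run_expect _ run')//.
by apply: (loop_prob good inv') => //; split => // -[k]; lia.
Qed.

(** The cost stays a function of the index [ci]; the expectation over the preprocessing is taken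
    afterwards. The constant 221 is 201 for preparing a query plus 20 for collecting its answer, and
    the final 1 is the exit jump. *)
Definition loop_cost (j : nat) (ci : config) : \bar RR :=
  \sum_(1 <= k < j.+1) (8%:R%:E *
    expected_time RR w qry (query_init (qv k) ci) + (2 * m + 221)%:R%:E) + 1.

Lemma loop_cost_ge0 j ci : 0 <= loop_cost j ci.
Proof.
apply: adde_ge0 => //; apply: sume_ge0 => k _.
by rewrite adde_ge0 ?mule_ge0 ?expected_time_ge0.
Qed.

Lemma loop_time j acc ci C : loop_inv j acc ci C -> (j <= 2 * n)%N ->
  expected_time RR w' P C <= loop_cost j ci.
Proof.
elim: j acc C => [|j IHj] acc C inv jn.
  have [C' run [hC' C'0]] := loop_exit_run inv.
  apply: (le_trans (det_run_time _ run)); rewrite expected_time_halted// adde0.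
  by rewrite /loop_cost big_geq// add0e.
have [t [C1 [tb1 run gl1 R1 [M1 si]]]] := loop_start_run inv jn.
have [_ _ _ Mi [Mc Mw Ms]] := inv.
have [g14 g13 _ _] := R1; have [_ _ _ [g10 g11 g12]] := gl1.
apply: (le_trans (det_run_time _ run)).
have [_ [_ _ c6] _ _] := reduction_code.
have h := @sim_expected_time w w' m off_query qry P w_gt0 ww' query_regs c6
  (regs C1) (memory C1) j.+1 (2 * W).
have {}h := h g10 g11 g12 g13 g14 (or_intror erefl) RR
  (fun=> 20%:R%:E + loop_cost j ci).
have c0 : 0 <= 20%:R%:E + loop_cost j ci by rewrite adde_ge0// loop_cost_ge0.
apply: (@le_trans _ _ (t%:R%:E + (8%:R%:E *
    expected_time RR w qry (query_init (qv j.+1) ci) +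
    (20%:R%:E + loop_cost j ci)))).
  rewrite leeD2l//; apply: le_trans (leeD2l _ (halt_expect_cst_le w qry _ c0)).
  apply: h si => //.
  move=> c' C' si' hc'; rewrite M1 in si'.
  have [t' [C'' [tb' run' inv']]] := loop_end_run gl1 R1 Mi Mc Mw Ms jn si' hc'.
  apply: (le_trans (det_run_time _ run')); apply: leeD.
    by rewrite lee_fin ler_nat.
  exact: IHj inv' (ltnW jn).
have -> : loop_cost j.+1 ci = loop_cost j ci + (8%:R%:E *
    expected_time RR w qry (query_init (qv j.+1) ci) + (2 * m + 221)%:R%:E).
  by rewrite /loop_cost big_nat_recr//= addeAC.
set X := loop_cost j ci; set e := 8%:R%:E * _.
have -> : t%:R%:E + (e + (20%:R%:E + X)) = X + (e + (t + 20)%:R%:E).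
  by rewrite (natrD _ t 20) EFinD [RHS]addeCA [LHS]addeCA; congr (e + _); rewrite addeA addeC.
by rewrite !leeD2l// lee_fin ler_nat; lia.
Qed.

(** [query_time] averages over both phases, so after subadditivity of [halt_expect] each of the
    [2 * n] queries is bounded by it separately, although they share an index. *)
Lemma reduction_time :
  expected_time RR w' P (conv3sum_init w' n x) <=
    (400 * s + 6 * c + 412)%:R%:E + 8%:R%:E * preprocessing_time RR 3 A s +
    (2 * n)%:R%:E * (8%:R%:E * query_time RR 3 A s + (2 * m + 221)%:R%:E).
Proof.
have [t [C1 [tle run gl R0 [[R13 R14 [Mi M2]] si]]]] := setup_run.
have [g1 _ _ [g10 g11 g12]] := gl.
apply: (le_trans (det_run_time _ run)).
have [[_ _ c2 _] _ _ _] := reduction_code.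
have F0 ci : 0 <= 10%:R%:E + loop_cost (2 * n) ci.
  by rewrite adde_ge0// loop_cost_ge0.
have h := @sim_expected_time w w' m off_pre pre P w_gt0 ww' preprocess_regs c2
  (regs C1) (memory C1) 0 0 g10 g11 g12 R13 R14 (or_introl erefl) RR _ F0.
apply: (le_trans (leeD2l _ (h _ _ _ si))).
  move=> ci C' si' hc'.
  have [t' [C'' [tb' run' inv']]] := start_loop_run gl R0 Mi M2 si' hc'.
  apply: (le_trans (det_run_time _ run')); apply: leeD.
    by rewrite lee_fin ler_nat.
  exact: loop_time inv' (leqnn _).
have pt : expected_time RR w pre (preprocess_init S) <=
    preprocessing_time RR 3 A s by apply: ereal_sup_ubound; exists S.
have qt k : (0 < k <= 2 * n)%N ->
    halt_expect w pre (fun ci => expected_time RR w qry (query_init (qv k) ci))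
      (preprocess_init S) <= query_time RR 3 A s.
  move=> kb; apply: ereal_sup_ubound; exists (S, qv k) => //.
  by split => //; exact: word_vector_query.
have lc : halt_expect w pre (fun ci => 10%:R%:E + loop_cost (2 * n) ci)
    (preprocess_init S) <= 11%:R%:E +
    (2 * n)%:R%:E * (8%:R%:E * query_time RR 3 A s + (2 * m + 221)%:R%:E).
  have et0 k ci : 0 <= 8%:R%:E * expected_time RR w qry (query_init (qv k) ci) +
      (2 * m + 221)%:R%:E by rewrite adde_ge0 ?mule_ge0 ?expected_time_ge0.
  pose G ci := \sum_(1 <= k < (2 * n).+1) (8%:R%:E *
    expected_time RR w qry (query_init (qv k) ci) + (2 * m + 221)%:R%:E).
  have G0 ci : 0 <= G ci by apply: sume_ge0.
  apply: (@le_trans _ _ (halt_expect w pre (fun ci => 11%:R%:E + G ci)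
      (preprocess_init S))).
    apply: le_halt_expect => ci; rewrite /loop_cost -/(G ci).
    by rewrite addeA addeAC -EFinD natr1.
  apply: le_trans.
    by apply: (@halt_expectD_le RR w pre (fun=> 11%:R%:E) G).
  apply: leeD; first exact: halt_expect_cst_le.
  apply: le_trans; first exact: halt_expect_sum_le.
  rewrite (_ : (2 * n)%:R%:E * _ = \sum_(1 <= k < (2 * n).+1)
      (8%:R%:E * query_time RR 3 A s + (2 * m + 221)%:R%:E)); last first.
    rewrite big_const_nat iter_addr_0 subSS subn0.
    by rewrite natmul_erealE.
  rewrite big_seq [leRHS]big_seq; apply: lee_sum => k.
  rewrite mem_index_iota ltnS => kb.
  apply: le_trans.
    apply: (@halt_expectD_le RR w pre (fun ci => 8%:R%:E *
      expected_time RR w qry (query_init (qv k) ci)) (fun=> (2 * m + 221)%:R%:E)).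
      by move=> ci; rewrite mule_ge0 ?expected_time_ge0.
    by [].
  apply: leeD; last exact: halt_expect_cst_le.
  apply: le_trans.
    apply: halt_expectZ_le => // ci; exact: expected_time_ge0.
  by rewrite lee_wpmul2l// qt.
apply: (le_trans (leeD2l _ (leeD (lee_wpmul2l _ pt) lc))) => //.
rewrite addeA addeA leeD2r// addeAC leeD2r// -EFinD lee_fin -natrD ler_nat.
by lia.
Qed.

End Expectation.
End Instance.
End Program.

(** * From the cost of the reduction to the lower bounds *)

Lemma sqrt_bound n : exists B, (n < B * B)%N /\ (B.-1 * B.-1 <= n)%N.
Proof.
have ex : exists B, (n < B * B)%N by exists n.+1; nia.
exists (ex_minn ex); case: ex_minnP => B nB Bmin; split => //.
by rewrite leqNgt; apply/negP => /Bmin; case: B nB {Bmin} => // B _; lia.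
Qed.

(** Squaring avoids half-integer powers: the length is at most [34 * (B * n)] and [B * B <= 4 * n],
    which gives the constant [34 * 34 * 4 = 68 * 68]. *)
Lemma text_size_sqr n B x : (0 < n)%N -> small_instance n x ->
  (n < B * B)%N -> (B.-1 * B.-1 <= n)%N ->
  (size (text n B x) * size (text n B x) <= 68 * 68 * (n * n * n))%N.
Proof.
move=> n0 xs nB Bm; have B0 := B_gt0 nB.
have BB : (B * B <= 4 * n)%N by case: (B) Bm => //= b; nia.
have sz : (size (text n B x) <= 34 * (B * n))%N.
  rewrite size_text// /gap.
  have := digit1_lt xs nB n; have := digit0_lt x nB n.
  have : (2 * n <= B * n)%N.
    by rewrite leq_mul2r; apply/orP; right; case: (B) nB => [|[|?]] //; lia.
  have : (B <= B * n)%N by rewrite leq_pmulr.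
  have -> : (2 * (2 * B + 1) * n = 4 * (B * n) + 2 * n)%N by lia.
  by lia.
apply: leq_trans (leq_mul sz sz) _.
have -> : (34 * (B * n) * (34 * (B * n)) = 34 * 34 * ((B * B) * (n * n)))%N.
  by rewrite mulnACA (mulnACA B).
apply: (@leq_trans (34 * 34 * (4 * n * (n * n)))).
  by rewrite leq_mul2l leq_mul2r BB !orbT.
rewrite (_ : 4 * n * (n * n) = 2 * 2 * (n * n * n))%N; last by rewrite !mulnA.
by rewrite mulnA (mulnACA 34 34 2 2).
Qed.

Definition reduction (A : indexing_algorithm) : algorithm :=
  @Algorithm (reduction_prog A) (6 * idx_word A + 1) (ltn_addl _ (ltn0Sn 0)).

Section Final.
Variable R : realType.
Variable A : indexing_algorithm.
Hypothesis A_solves : solves_jumbled_indexing R 3 A.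

Lemma reduction_solves : solves_conv3sum R (reduction A).
Proof.
move=> n x xs; rewrite /reduction /=.
have [n0|n0] := posnP n; last first.
  have [B [nB Bm]] := sqrt_bound n; exact: (reduction_correct n0 xs nB Bm).
have [[c0 _ _ _] _ _ _] := reduction_code A; set w := word_bits _ _.
have := @det_run_jump_if_zero w (reduction_prog A) 0 0 (off_end A)
  (upd (fun=> 0%N) 0 n) (memory (conv3sum_init w n x)).
rewrite upd_same n0 eqxx => run.
have {}run := run (leq_ltn_trans (leq0n _) (eq_ind_r (fun t => off_loop A < t)%N
  (off_loop_lt A) (size_reduction_prog A))) c0.
rewrite /halt_prob /conv3sum_init /= (det_run_expect _ run)//.
rewrite halt_expect_halted; last by rewrite /halted size_reduction_prog.
rewrite indicE mem_set//; split => // -[i [j [j0 ji i0 _]]].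
by move: ji; rewrite ltnNge (leq_trans i0).
Qed.

Lemma powR_size_le (s n : nat) (t : R) : (s * s <= 68 * 68 * (n * n * n))%N ->
  0 <= t <= 1 -> s%:R `^ (2 * t) <= 68 * 68 * n%:R `^ (3 * t).
Proof.
move=> sn /andP[t0 t1]; rewrite !powRrM -[2]/(2%:R) -[3]/(3%:R) !powR_mulrn//.
apply: (@le_trans _ _ ((68 * 68 * n%:R ^+ 3) `^ t)).
  apply: ge0_ler_powR => //; rewrite ?nnegrE ?mulr_ge0 ?exprn_ge0//.
  rewrite expr2 !exprS expr0 mulr1 -!natrM ler_nat.
  by apply: leq_trans sn _; rewrite !mulnA.
rewrite powRM ?exprn_ge0// ler_wpM2r ?powR_ge0//.
by rewrite -[leRHS]powRr1 ?ler_powR//; lra.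
Qed.

Lemma not_Omega_lt (f : nat -> \bar R) (g : nat -> R) : ~ is_Omega f g ->
  exists N, forall n, (N <= n)%N -> (f n <= (g n)%:E)%E.
Proof.
move=> nO; apply: contrapT => h; apply: nO; exists 1 => // N.
apply: contrapT => h'; apply: h; exists N => n Nn.
by rewrite leNgt; apply/negP => fg; apply: h'; exists n => //; rewrite mul1r ltW.
Qed.

(** Writing the text already costs time of order n to the power 3/2; the bound [e <= 1 / 3] is what
    keeps this below the target exponent [2 - 3 / 2 * e]. For the other terms, [s] to a power [u] is
    of order [n] to the power [3 / 2 * u]. *)
Lemma reduction_time_le (e : R) (N : nat) : 0 < e <= 1 / 3 ->
  (forall s, (N <= s)%N ->
     (preprocessing_time R 3 A s <= (s%:R `^ (4 / 3 - e))%:E)%E) ->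
  (forall s, (N <= s)%N ->
     (query_time R 3 A s <= (s%:R `^ (2 / 3 - e))%:E)%E) ->
  exists2 K : R, 0 < K & forall n, (0 < n)%N -> (N <= n)%N ->
    (conv3sum_time R (reduction A) n <= (K * n%:R `^ (2 - 3 / 2 * e))%:E)%E.
Proof.
move=> /andP[e0 e1] preN qryN.
pose k1 : R := (6 * idx_word A + 412)%:R.
pose k2 : R := (2 * sim_regs_num A + 221)%:R.
have k10 : 0 <= k1 by []. have k20 : 0 <= k2 by [].
pose K : R := 400 * (68 * 68) + k1 + 8 * (68 * 68) + 2 * (8 * (68 * 68) + k2).
exists K; first by rewrite /K; lra.
move=> n n0 Nn; apply: ge_ereal_sup => _ [x xs <-].
have [B [nB Bm]] := sqrt_bound n.
apply: (le_trans (reduction_time A n0 xs nB Bm R)).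
have ss := text_size_sqr n0 xs nB Bm.
have ns : (n <= size (text n B x))%N.
  by have := n_le_size n0 xs nB Bm; lia.
set s := size _ in ss ns *.
have Ns := leq_trans Nn ns.
have n1 : 1 <= n%:R :> R by rewrite ler1n.
set h : R := n%:R `^ (2 - 3 / 2 * e).
have h1 : 1 <= h.
  by rewrite /h -[leLHS](powRr0 n%:R) ler_powR//; lra.
have sh : s%:R <= 68 * 68 * h :> R.
  have := @powR_size_le s n (1 / 2) ss; rewrite (_ : 2 * (1 / 2) = 1); last by lra.
  rewrite powRr1// => /(_ _)/le_trans; apply; first by lra.
  by rewrite ler_wpM2l// ler_powR//; lra.
have ph : (preprocessing_time R 3 A s <= (68 * 68 * h)%:E)%E.
  apply: (le_trans (preN _ Ns)); rewrite lee_fin.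
  have := @powR_size_le s n ((4 / 3 - e) / 2) ss.
  rewrite (_ : 2 * ((4 / 3 - e) / 2) = 4 / 3 - e); last by lra.
  rewrite (_ : 3 * ((4 / 3 - e) / 2) = 2 - 3 / 2 * e); last by lra.
  by apply; lra.
have qh : (query_time R 3 A s <= (68 * 68 * n%:R `^ (1 - 3 / 2 * e))%:E)%E.
  apply: (le_trans (qryN _ Ns)); rewrite lee_fin.
  have := @powR_size_le s n ((2 / 3 - e) / 2) ss.
  rewrite (_ : 2 * ((2 / 3 - e) / 2) = 2 / 3 - e); last by lra.
  rewrite (_ : 3 * ((2 / 3 - e) / 2) = 1 - 3 / 2 * e); last by lra.
  by apply; lra.
have nh : n%:R * n%:R `^ (1 - 3 / 2 * e) = h.
  rewrite -{1}[n%:R]powRr1// -powRD; last by rewrite pnatr_eq0 -lt0n n0 implybT.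
  by congr (_ `^ _); lra.
have nh' : n%:R <= h.
  by rewrite -[leLHS]powRr1// ler_powR//; lra.
apply: (@le_trans _ _ ((400 * s + 6 * idx_word A + 412)%:R%:E +
    8%:R%:E * (68 * 68 * h)%:E + (2 * n)%:R%:E *
    (8%:R%:E * (68 * 68 * n%:R `^ (1 - 3 / 2 * e))%:E +
     (2 * sim_regs_num A + 221)%:R%:E))%E).
  apply: leeD; first by rewrite leeD2l// lee_wpmul2l.
  by rewrite lee_wpmul2l// leeD2r// lee_wpmul2l.
rewrite -!(EFinM, EFinD) lee_fin -/k2.
rewrite -addnA natrD -/k1 natrM (natrM _ 2 n).
have : 2 * n%:R * (8 * (68 * 68 * n%:R `^ (1 - 3 / 2 * e)) + k2) <=
    2 * (8 * (68 * 68) + k2) * h.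
  have nk : n%:R * k2 <= h * k2 by rewrite ler_wpM2r.
  rewrite (_ : 2 * _ * _ = 16 * (68 * 68) * (n%:R * n%:R `^ (1 - 3 / 2 * e)) +
    2 * (n%:R * k2)); last by ring.
  by rewrite nh; lra.
move=> Xh; have kh : k1 <= k1 * h by rewrite ler_peMr.
rewrite (_ : K * h = 400 * (68 * 68 * h) + k1 * h + 8 * (68 * 68 * h) +
  2 * (8 * (68 * 68) + k2) * h); last by rewrite /K; ring.
by rewrite lerD// lerD// lerD// ler_wpM2l.
Qed.

End Final.

Theorem theorem3 (R : realType) (hard : strong_3sum_hardness R)
    (eps : R) (eps_gt0 : 0 < eps)
    (A : indexing_algorithm) (A_solves : solves_jumbled_indexing R 3 A) :
  is_Omega (preprocessing_time R 3 A) (fun s => s%:R `^ (4 / 3 - eps))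
  \/ is_Omega (query_time R 3 A) (fun s => s%:R `^ (2 / 3 - eps)).
Proof.
apply: contrapT => /not_orP[/not_Omega_lt[N1 h1] /not_Omega_lt[N2 h2]].
(* Replacing [eps] by a smaller number only weakens the assumed upper bounds, and it meets the
   requirement of [reduction_time_le]. *)
pose e := Num.min eps (1 / 3).
have e0 : 0 < e by rewrite lt_min eps_gt0 /=; lra.
have eE : e <= eps by rewrite ge_min lexx.
have e13 : e <= 1 / 3 by rewrite ge_min lexx orbT.
pose N := maxn 1 (maxn N1 N2).
have pw (s : nat) (t : R) : (N <= s)%N -> s%:R `^ (t - eps) <= s%:R `^ (t - e).
  by move=> Ns; rewrite ler_powR ?lerB// ler1n; move: Ns; rewrite /N; lia.
have [K K0 TK] : exists2 K : R, 0 < K & forall n, (0 < n)%N -> (N <= n)%N ->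
    (conv3sum_time R (reduction A) n <= (K * n%:R `^ (2 - 3 / 2 * e))%:E)%E.
  apply: (@reduction_time_le R A e N); first by rewrite e0.
    move=> s Ns; apply: (@le_trans _ _ (s%:R `^ (4 / 3 - eps))%:E).
      by apply: h1; move: Ns; rewrite /N; lia.
    by rewrite lee_fin pw.
  move=> s Ns; apply: (@le_trans _ _ (s%:R `^ (2 / 3 - eps))%:E).
    by apply: h2; move: Ns; rewrite /N; lia.
  by rewrite lee_fin pw.
have [a a0 aN] := hard _ (reduction_solves A_solves) e e0.
(* The lower bound with exponent [2 - e] outgrows the upper bound with exponent [2 - 3 / 2 * e] by
   the factor [n] to the power [e / 2], which exceeds [K / a] once [n] is greater than [b]. *)
pose b := (K / a) `^ (2 / e).
have b0 : 0 <= b := powR_ge0 _ _.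
have [n nN aT] := aN (maxn N (Num.bound b)).
have nN1 : (N <= n)%N by apply: leq_trans nN; exact: leq_maxl.
have n0 : (0 < n)%N by apply: leq_trans nN1; exact: leq_maxl.
have bn : b < n%:R.
  apply: (lt_le_trans (archi_boundP b0)); rewrite ler_nat.
  by apply: leq_trans nN; exact: leq_maxr.
have := le_trans aT (TK n n0 nN1); rewrite lee_fin.
rewrite (_ : 2 - e = (2 - 3 / 2 * e) + e / 2); last by lra.
rewrite powRD; last by rewrite pnatr_eq0 -lt0n n0 implybT.
rewrite mulrCA mulrC ler_pM2r; last by rewrite powR_gt0// ltr0n.
apply/negP; rewrite -ltNge mulrC -ltr_pdivrMr//.
have -> : K / a = b `^ (e / 2).
  rewrite /b -powRrM (_ : 2 / e * (e / 2) = 1) ?powRr1//.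
    by rewrite divr_ge0// ltW.
  by field; rewrite gt_eqF.
by apply: gt0_ltr_powR; rewrite ?nnegrE// divr_gt0.
Qed.
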